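(* Let $T_\lambda=\sum_{n\ge 0}\frac{\lambda^n}{n!}T_n$ be a homogeneous conformal averaging operator on a finite-dimensional semisimple Lie algebra $\mathfrak g$ over $\mathbb C$. Then the operator-valued meromorphic function $P: \mathbb C\setminus\{0\} \to \operatorname{End} \mathfrak g $ given by $$P_u(a) = \sum\limits_{n\ge 0} \dfrac{1}{u^{n+1} }T_n(a), \quad a\in \mathfrak g, \ u\in \mathbb C\setminus\{0\},$$ is a solution of the (operator form of the) classical Yang--Baxter equation $$P_{u+v}([x,P^*_u(y)]) - P_v([P_u(x),y])+[P_{u+v}(x),P_v(y)]=0$$ for all $x,y\in\mathfrak g$ and all $u,v\in\mathbb C$ with $u,v,u+v\neq 0$.
   Context: All spaces are over $\mathbb C$. A conformal averaging operator on a Lie algebra $\mathfrak g$ is a linear map $T_\lambda:\mathfrak g\to\mathfrak g[\lambda]$ ($\lambda,\mu$ formal variables) such that $$T_{\lambda+\mu}([T_\lambda (x),y]) = [T_\lambda (x), T_\mu(y)] \in \mathfrak g[\lambda, \mu ]\quad\text{for all }x,y\in\mathfrak g,$$ where maps and brackets are extended linearly in the polynomial variables; the $T_n$ are the linear transformations of $\mathfrak g$ determined by $T_\lambda(a)=\sum_{n\ge 0}\frac{\lambda^n}{n!}T_n(a)$. For a subspace $B\subseteq\mathfrak g$, $T_*(B)$ denotes the linear span of all $T_\alpha(b)$, $b\in B$, $\alpha\in\mathbb C$ ($T_\alpha(b)$ is the value of the polynomial $T_\lambda(b)$ at $\lambda=\alpha$). For $\mathfrak g$ semisimple, $T_\lambda$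 is called homogeneous if $T_*(\mathfrak g)$ contains a Cartan subalgebra of $\mathfrak g$. For $P\in\operatorname{End}\mathfrak g$ (linear maps $\mathfrak g\to\mathfrak g$), $P^*$ denotes the adjoint of $P$ with respect to the Killing form of $\mathfrak g$. *)

(* Defs.v *)
From HB Require Import structures.
From mathcomp Require Import all_boot all_order all_algebra.
From mathcomp Require Import finmap complex.
From mathcomp Require Import boolp classical_sets reals topology normedtype.
From mathcomp Require Import derive.

Set Implicit Arguments.
Unset Strict Implicit.
Unset Printing Implicit Defensive.

Import Order.TTheory GRing.Theory Num.Theory.
Import numFieldNormedType.Exports.

Local Open Scope ring_scope.

HB.mixin Record Vector_isLie (K : fieldType) L of Vector K L := {
  lie : L -> L -> L;
  lie_linearl : forall y, linear (fun x => lie x y);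
  lie_linearr : forall x, linear (lie x);
  liexx : forall x, lie x x = 0;
  lie_jacobi : forall x y z,
    lie x (lie y z) + lie y (lie z x) + lie z (lie x y) = 0
}.

#[short(type="lieAlgType")]
HB.structure Definition LieAlg (K : fieldType) :=
  { L of Vector_isLie K L & Vector K L }.

Section LieTheory.
Variables (K : fieldType) (g : lieAlgType K).
Implicit Types (U V H I : {vspace g}) (f : 'End(g)).

HB.instance Definition _ (x : g) :=
  GRing.isLinear.Build K g g *:%R (@lie K g x) (@lie_linearr K g x).

Definition ad (x : g) : 'End(g) := linfun (lie x).

Lemma adE x y : ad x y = lie x y.
Proof. by rewrite lfunE. Qed.

(* By bilinearity, the span of all lie u v with u \in U and v \in V. *)
Definition lie_vs U V : {vspace g} :=
  <<[seq lie u v | u <- vbasis U, v <- vbasis V]>>%VS.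

Definition lie_ideal I : Prop := (lie_vs fullv I <= I)%VS.

Definition lie_subalgebra H : Prop := (lie_vs H H <= H)%VS.

Definition lie_solvable U : Prop :=
  exists n, iter n (fun V => lie_vs V V) U = 0%VS.

Definition lie_nilpotent U : Prop := exists n, iter n (lie_vs U) U = 0%VS.

Definition semisimple : Prop :=
  forall I, lie_ideal I -> lie_solvable I -> I = 0%VS.

(* Nilpotent self-normalizing subalgebra. *)
Definition cartan_subalgebra H : Prop :=
  [/\ lie_subalgebra H, lie_nilpotent H &
      forall x, (forall h, h \in H -> lie x h \in H) -> x \in H].

Definition lfun_trace f : K := \tr (passmx.mxof (vbasis fullv) (vbasis fullv) f).

Definition killing (x y : g) : K := lfun_trace (ad x \o ad y)%VF.

(* For a nondegenerate Killing form (in particular for g semisimple over a    *)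
(* field of characteristic 0) there is exactly one such Q; the default value  *)
(* 0 is only used when there is none.                                         *)
Definition killing_adj f : 'End(g) :=
  xget 0 [set Q : 'End(g) |
    forall x y, killing (f x) y = killing x (Q y)]%classic.

End LieTheory.

(* Finitely supported families of coefficients: vpoly nat V is V[lambda], and *)
(* vpoly (nat * nat) V is V[lambda, mu], the index (i, j) being that of the   *)
(* monomial lambda^i mu^j.                                                    *)
Definition vpoly (I : choiceType) (K : fieldType) (V : lmodType K) : Type :=
  {fsfun I -> V with 0}.

Section VPoly.
Variables (I : choiceType) (K : fieldType) (V : lmodType K).
Local Notation vpoly := (vpoly I V).
Implicit Types (p q : vpoly) (i : I) (c : K) (v : V).

HB.instance Definition _ := Choice.copy vpoly {fsfun I -> V with 0}.

Definition vcoef p i : V := (p : {fsfun I -> V with 0}) i.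

Definition vsupp p : {fset I} := finsupp (p : {fsfun I -> V with 0}).

Definition vmono i v : vpoly := [fsfun j in [fset i]%fset => v].

Definition vpoly0 : vpoly := [fsfun].
Definition vpoly_opp p : vpoly := [fsfun i in vsupp p => - vcoef p i].
Definition vpoly_add p q : vpoly :=
  [fsfun i in (vsupp p `|` vsupp q)%fset => vcoef p i + vcoef q i].
Definition vpoly_scale c p : vpoly := [fsfun i in vsupp p => c *: vcoef p i].

Lemma vpolyP p q : (forall i, vcoef p i = vcoef q i) <-> p = q.
Proof. exact: fsfunP. Qed.

Lemma vcoef_notin p i : i \notin vsupp p -> vcoef p i = 0.
Proof. exact: fsfun_dflt. Qed.

Lemma vcoef0_subproof i : vcoef vpoly0 i = 0.
Proof. by rewrite /vcoef fsfun0E. Qed.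

Lemma vcoefN_subproof p i : vcoef (vpoly_opp p) i = - vcoef p i.
Proof.
by rewrite {1}/vcoef fsfunE; case: ifPn => // /vcoef_notin ->; rewrite oppr0.
Qed.

Lemma vcoefD_subproof p q i :
  vcoef (vpoly_add p q) i = vcoef p i + vcoef q i.
Proof.
rewrite {1}/vcoef fsfunE in_fsetU; case: ifPn => //.
by rewrite negb_or => /andP[/vcoef_notin -> /vcoef_notin ->]; rewrite addr0.
Qed.

Lemma vcoefZ_subproof c p i : vcoef (vpoly_scale c p) i = c *: vcoef p i.
Proof.
by rewrite {1}/vcoef fsfunE; case: ifPn => // /vcoef_notin ->; rewrite scaler0.
Qed.

Let vcoefE :=
  (vcoef0_subproof, vcoefN_subproof, vcoefD_subproof, vcoefZ_subproof).

Lemma vpoly_addA : associative vpoly_add.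
Proof. by move=> p q r; apply/vpolyP => i; rewrite !vcoefE addrA. Qed.

Lemma vpoly_addC : commutative vpoly_add.
Proof. by move=> p q; apply/vpolyP => i; rewrite !vcoefE addrC. Qed.

Lemma vpoly_add0 : left_id vpoly0 vpoly_add.
Proof. by move=> p; apply/vpolyP => i; rewrite !vcoefE add0r. Qed.

Lemma vpoly_addN : left_inverse vpoly0 vpoly_opp vpoly_add.
Proof. by move=> p; apply/vpolyP => i; rewrite !vcoefE addNr. Qed.

HB.instance Definition _ := GRing.isZmodule.Build vpoly
  vpoly_addA vpoly_addC vpoly_add0 vpoly_addN.

Lemma vpoly_scaleA a b p :
  vpoly_scale a (vpoly_scale b p) = vpoly_scale (a * b) p.
Proof. by apply/vpolyP => i; rewrite !vcoefE scalerA. Qed.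

Lemma vpoly_scale1 : left_id 1 vpoly_scale.
Proof. by move=> p; apply/vpolyP => i; rewrite !vcoefE scale1r. Qed.

Lemma vpoly_scaleDr : right_distributive vpoly_scale +%R.
Proof. by move=> a p q; apply/vpolyP => i; rewrite !vcoefE scalerDr. Qed.

Lemma vpoly_scaleDl p :
  {morph vpoly_scale^~ p : a b / a + b >-> a + b}.
Proof. by move=> a b; apply/vpolyP => i; rewrite !vcoefE scalerDl. Qed.

HB.instance Definition _ := GRing.Zmodule_isLmodule.Build K vpoly
  vpoly_scaleA vpoly_scale1 vpoly_scaleDr vpoly_scaleDl.

Lemma vcoef0 i : vcoef (0 : vpoly) i = 0.
Proof. exact: vcoef0_subproof. Qed.

Lemma vcoefD p q i : vcoef (p + q) i = vcoef p i + vcoef q i.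
Proof. exact: vcoefD_subproof. Qed.

Lemma vcoefZ c p i : vcoef (c *: p) i = c *: vcoef p i.
Proof. exact: vcoefZ_subproof. Qed.

Lemma vcoef_mono i v j : vcoef (vmono i v) j = if j == i then v else 0.
Proof. by rewrite /vcoef fsfunE in_fset1. Qed.

End VPoly.

(* The value at lambda = a. *)
Definition veval (K : fieldType) (V : lmodType K) (p : vpoly nat V) (a : K) : V :=
  \sum_(n <- vsupp p) a ^+ n *: vcoef p n.

Section Conformal.
Variables (K : fieldType) (g : lieAlgType K).
Variable T : {linear g -> vpoly nat g}.
Implicit Types (p q : vpoly nat g) (B : {vspace g}).

(* [p(lambda), y] *)
Definition lie_vpolyl p (y : g) : vpoly nat g :=
  \sum_(m <- vsupp p) vmono m (lie (vcoef p m) y).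

(* [p(lambda), q(mu)] *)
Definition lie_vpoly p q : vpoly (nat * nat)%type g :=
  \sum_(m <- vsupp p) \sum_(n <- vsupp q)
    vmono (m, n) (lie (vcoef p m) (vcoef q n)).

(* T_{lambda+mu}(p(lambda)): if p(lambda) = sum_m lambda^m p_m and            *)
(* T_lambda(p_m) = sum_n lambda^n t_{m,n}, this is                            *)
(* sum_m sum_n lambda^m (lambda + mu)^n t_{m,n}, expanded binomially.         *)
Definition T_sum p : vpoly (nat * nat)%type g :=
  \sum_(m <- vsupp p) \sum_(n <- vsupp (T (vcoef p m))) \sum_(i < n.+1)
    vmono ((m + i)%N, (n - i)%N) (vcoef (T (vcoef p m)) n *+ 'C(n, i)).

Definition conformal_averaging : Prop :=
  forall x y : g, T_sum (lie_vpolyl (T x) y) = lie_vpoly (T x) (T y).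

(* Membership in the linear span of the T_a(b), b \in B, a in the field. *)
Definition T_star B (x : g) : Prop :=
  exists2 s : seq (K * g), (forall c, c \in s -> c.2 \in B) &
    x \in <<[seq veval (T c.2) c.1 | c <- s]>>%VS.

Definition homogeneous : Prop :=
  exists2 H : {vspace g}, cartan_subalgebra H &
    forall h, h \in H -> T_star fullv h.

(* T_lambda(a) = sum_n lambda^n / n! T_n(a), so that T_n(a) is n! times the   *)
(* coefficient of lambda^n.                                                   *)
Definition Tn_fun (n : nat) (a : g) : g := n`!%:R *: vcoef (T a) n.

Lemma Tn_fun_linear n : linear (Tn_fun n).
Proof.
move=> c a b; rewrite /Tn_fun linearP vcoefD vcoefZ scalerDr !scalerA.
by rewrite mulrC.
Qed.

HB.instance Definition _ n :=
  GRing.isLinear.Build K g g *:%R (Tn_fun n) (Tn_fun_linear n).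

Definition Tn (n : nat) : 'End(g) := linfun (Tn_fun n).

Definition P_fun (u : K) (a : g) : g :=
  \sum_(n <- vsupp (T a)) (u ^+ n.+1)^-1 *: Tn n a.

Lemma P_fun_widen u a (D : {fset nat}) : (vsupp (T a) `<=` D)%fset ->
  P_fun u a = \sum_(n <- D) (u ^+ n.+1)^-1 *: Tn n a.
Proof.
move=> sD; apply: big_fset_incl => // n _ /vcoef_notin Tan0.
by rewrite lfunE /= /Tn_fun Tan0 !scaler0.
Qed.

Lemma P_fun_linear u : linear (P_fun u).
Proof.
move=> c a b.
pose D := (vsupp (T (c *: a + b)%R) `|` (vsupp (T a) `|` vsupp (T b)))%fset.
have sDa : (vsupp (T a) `<=` D)%fset.
  by rewrite /D fsetUCA fsubsetUl.
have sDb : (vsupp (T b) `<=` D)%fset.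
  by rewrite /D fsetUA fsubsetUr.
rewrite (P_fun_widen _ (fsubsetUl _ _ : _ `<=` D)%fset).
rewrite (P_fun_widen _ sDa) (P_fun_widen _ sDb) scaler_sumr -big_split /=.
by apply: eq_bigr => n _; rewrite linearP scalerDr !scalerA mulrC.
Qed.

HB.instance Definition _ u :=
  GRing.isLinear.Build K g g *:%R (P_fun u) (P_fun_linear u).

(* Only u != 0 is meaningful. *)
Definition P_ (u : K) : 'End(g) := linfun (P_fun u).

Lemma P_E u a : P_ u a = \sum_(n <- vsupp (T a)) (u ^+ n.+1)^-1 *: Tn n a.
Proof. by rewrite lfunE. Qed.

End Conformal.

Section Meromorphic.
Variable R : realType.
Local Notation C := R[i].
Local Open Scope classical_set_scope.

(* The derivative at z in direction 1, with increments in C, is the complex   *)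
(* derivative.                                                                *)
Definition holomorphic_at (f : C^o -> C^o) (c : C^o) : Prop :=
  \forall z \near c, derivable f z 1.

Definition meromorphic_at (f : C^o -> C^o) (c : C^o) : Prop :=
  exists k : nat, exists2 h : C^o -> C^o, holomorphic_at h c &
    \forall z \near c^', (z - c) ^+ k * f z = h z.

(* Operator-valued meromorphic function, holomorphic on C \ {0}; stated for   *)
(* all the scalar functions z |-> phi (Q z a), phi a linear functional.       *)
Definition op_meromorphic (g : vectType C) (Q : C -> 'End(g)) : Prop :=
  forall (phi : {linear g -> C^o}) (a : g),
    (forall c : C, c != 0 -> holomorphic_at (fun z => phi (Q z a)) c) /\
    meromorphic_at (fun z => phi (Q z a)) 0.

End Meromorphic.

(* Main.v *)
(* Write [T_lambda = sum_n lambda^n tau_n] and let S be the span of the images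
   of the tau_n; it is a subalgebra containing the Cartan subalgebra H.  The
   averaging identity reads
     sum_(i <= m) 'C(k + i, i) tau_(k + i) [tau_(m - i) x, y] = [tau_m x, tau_k y].
   Descending induction on m >= 1 and sl2 theory for weight vectors of H give
   tau_m [S, g] = 0 = [S, tau_m g], so that tau_0 commutes with ad S and
   P_u = u^-1 tau_0 on [S, g].  A weight vector orthogonal to S is killed by all
   tau_n, hence the adjoint of P_u takes its values in S.  The Yang-Baxter
   equation then reduces to
     1 / (u (u + v)) - 1 / (u v) + 1 / (v (u + v)) = 0
   times [tau_0 x, tau_0 y].

   Nondegeneracy of the Killing form and diagonalizability of ad H both use, for
   an additive f : K -> K, the operator acting as f(a) on the generalized
   eigenspace of ad x for a: it is a derivation. *)
From HB Require Import structures.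
Require Import Defs.
From mathcomp Require Import all_boot all_order all_algebra.
From mathcomp Require Import ring.
From mathcomp Require Import finmap complex boolp classical_sets functions.
From mathcomp Require Import reals topology normedtype derive.

Set Implicit Arguments.
Unset Strict Implicit.
Unset Printing Implicit Defensive.

Import Order.TTheory GRing.Theory Num.Theory passmx.
Import numFieldNormedType.Exports.

Local Open Scope ring_scope.

(** * Polynomials in an endomorphism and generalized eigenvectors *)

(** Homogeneity enters through the inclusion of H in S: whatever is proved for [ad a], a in S, holds
    for [ad h], so a [tau_m] commuting with ad S preserves weights and can be studied on weight
    vectors. The descent is driven by tau_m [tau_m x, y] = 0 for x of nonzero weight, which is read
    off the averaging identity in degree m - 1 of mu. It therefore stops before m = 0, and tau_0 is
    the coefficient that survives. The awkward term of the Yang-Baxter equation is the one with the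
    adjoint. As its values lie in S, P_(u+v) acts there through its simple pole, and invariance of
    the Killing form moves the adjoint back: [P_u^* y, tau_0 x] = - u^-1 [tau_0 x, tau_0 y]. Two
    functions f are used. Complex conjugation turns the trace of ad x composed with the operator
    into a sum of |a|^2, so that a zero trace forces nilpotency (Cartan's criterion); the identity
    gives the semisimple part of [ad h]. *)

Section PolynomialAction.
Variables (K : fieldType) (V : vectType K).
Implicit Types (A B : 'End(V)) (p q : {poly K}) (v : V) (U W : {vspace V}).

(** This is p(A) v. Acting on vectors keeps the zero space in scope, where 1 = 0 among the
    endomorphisms. *)
Definition pact A p v : V := \sum_(i < size p) p`_i *: iter i A v.

Lemma pact_widen A p v n : (size p <= n)%N ->
  pact A p v = \sum_(i < n) p`_i *: iter i A v.
Proof.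
move=> le; rewrite /pact (big_ord_widen n (fun i => p`_i *: iter i A v)) //.
rewrite big_mkcond /=; apply: eq_bigr => i _; case: ltnP => // h.
by rewrite nth_default // scale0r.
Qed.

Lemma iter_linear A n : linear (iter n A).
Proof. by elim: n => //= n IH c u v; rewrite /= (IH c u v) linearP. Qed.

HB.instance Definition _ A n :=
  GRing.isLinear.Build K V V *:%R (iter n A) (iter_linear A n).

Lemma pact_linear A p : linear (pact A p).
Proof.
move=> c u v; rewrite /pact scaler_sumr -big_split /=; apply: eq_bigr => i _.
by rewrite iter_linear scalerDr !scalerA mulrC.
Qed.

HB.instance Definition _ A p :=
  GRing.isLinear.Build K V V *:%R (pact A p) (pact_linear A p).

Lemma pactD A p q v : pact A (p + q) v = pact A p v + pact A q v.
Proof.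
set n := maxn (size p) (size q).
rewrite (@pact_widen A (p + q) v n) ?size_polyD //.
rewrite (@pact_widen A p v n) ?leq_maxl // (@pact_widen A q v n) ?leq_maxr //.
by rewrite -big_split /=; apply: eq_bigr => i _; rewrite coefD scalerDl.
Qed.

Lemma pactZ A c p v : pact A (c *: p) v = c *: pact A p v.
Proof.
rewrite (@pact_widen A (c *: p) v (size p)) ?size_scale_leq //.
by rewrite scaler_sumr; apply: eq_bigr => i _; rewrite coefZ scalerA.
Qed.

Lemma pactN A p v : pact A (- p) v = - pact A p v.
Proof. by rewrite -scaleN1r pactZ scaleN1r. Qed.

Lemma pactC A c v : pact A c%:P v = c *: v.
Proof.
rewrite (@pact_widen A c%:P v 1) ?size_polyC_leq1 // big_ord1 /=.
by rewrite coefC.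
Qed.

Lemma pact0 A v : pact A 0 v = 0.
Proof. by rewrite -polyC0 pactC scale0r. Qed.

Lemma pactMX A p v : pact A (p * 'X) v = A (pact A p v).
Proof.
rewrite (@pact_widen A (p * 'X) v (size p).+1); last first.
  by rewrite (leq_trans (size_polyMleq _ _)) // size_polyX addn2.
rewrite big_ord_recl coefMX /= scale0r add0r linear_sum /=.
by apply: eq_bigr => i _; rewrite coefMX /= linearZ.
Qed.

Lemma pactM A p q v : pact A (p * q) v = pact A p (pact A q v).
Proof.
elim/poly_ind: p => [|p c IH]; first by rewrite mul0r !pact0.
rewrite mulrDl !pactD -mulrA ['X * q]mulrC mulrA !pactMX IH; congr (_ + _).
by rewrite mul_polyC pactZ pactC.
Qed.

Lemma pactX A v : pact A 'X v = A v.
Proof. by rewrite -[X in pact _ X]mul1r pactMX -polyC1 pactC scale1r. Qed.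

Lemma pactXn A n v : pact A ('X^n) v = iter n A v.
Proof.
elim: n => [|n IH] in v *; first by rewrite expr0 -polyC1 pactC scale1r.
by rewrite exprSr pactMX IH.
Qed.

Lemma pactC_comm A p q v : pact A p (pact A q v) = pact A q (pact A p v).
Proof. by rewrite -!pactM mulrC. Qed.

Lemma pact_comm A B p v : (forall w, B (A w) = A (B w)) ->
  B (pact A p v) = pact A p (B v).
Proof.
move=> AB; rewrite linear_sum; apply: eq_bigr => i _; rewrite linearZ; congr (_ *: _).
by elim: (nat_of_ord i) => //= n IH; rewrite AB IH.
Qed.

Lemma pact_stable A p U v : (forall u, u \in U -> A u \in U) ->
  v \in U -> pact A p v \in U.
Proof.
move=> AU vU; apply: memv_suml => i _; apply: memvZ.
by elim: (nat_of_ord i) => //= n IH; apply: AU.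
Qed.

(** With n the dimension of the endomorphism space, the n + 1 powers A^0, ..., A^n are linearly
    dependent; a relation between them is p. *)
Lemma annihilator A : exists2 p, p != 0 & forall v, pact A p v = 0.
Proof.
pose n := \dim {:'End(V)}.
pose X := [tuple (linfun (iter i A) : 'End(V)) | i < n.+1].
have nfX : ~~ free X.
  apply/negP; rewrite /free size_tuple => /eqP dX.
  by have := dimvS (subvf <<X>>%VS); rewrite dX ltnn.
have [k kX [i ki]] : exists2 k : 'I_n.+1 -> K, \sum_i k i *: X`_i = 0 & exists i, k i != 0.
  apply/not_exists2P => h; move/negP: nfX; apply; apply/freeP => k kX i.
  case: (h k) => // nk; apply: contrapT => /eqP ki; apply: nk.
  by exists i.
pose p := \poly_(j < n.+1) k (inord j).
exists p.
  apply/eqP => /(congr1 (fun q : {poly K} => q`_i)).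
  by rewrite coef0 coef_poly ltn_ord inord_val; apply/eqP.
move=> v; rewrite (@pact_widen A p v n.+1) ?size_poly //.
have := congr1 (fun f : 'End(V) => f v) kX; rewrite sum_lfunE zero_lfunE => {2}<-.
apply: eq_bigr => j _; rewrite coef_poly ltn_ord inord_val.
by rewrite scale_lfunE -tnth_nth tnth_mktuple lfunE.
Qed.

End PolynomialAction.

Section GeneralizedEigenvectors.
Variables (K : closedFieldType) (V : vectType K).
Implicit Types (A B : 'End(V)) (p q : {poly K}) (v w : V) (U W : {vspace V}).
Implicit Types (a b : K).

Lemma bezout1 p q : coprimep p q -> exists u t : {poly K}, u * p + t * q = 1.
Proof.
move=> /Bezout_coprimepP [[u t] /= /eqpP [[c d] /= /andP[c0 d0] e]].
exists (d^-1 * c *: u), (d^-1 * c *: t); rewrite -!scalerAl -scalerDr -scalerA e.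
by rewrite scalerA mulVf // scale1r.
Qed.

Lemma coprimep_prod p (T : eqType) (s : seq T) (F : T -> {poly K}) :
  (forall z, z \in s -> coprimep p (F z)) -> coprimep p (\prod_(z <- s) F z).
Proof.
elim: s => [|z s IH] h; first by rewrite big_nil coprimep1.
rewrite big_cons coprimepMr h ?mem_head //=.
by apply: IH => y ys; apply: h; rewrite inE ys orbT.
Qed.

Lemma coprime_XsubC_exp a b n : a != b ->
  coprimep (('X - a%:P) ^+ n) ('X - b%:P).
Proof. by move=> ab; rewrite coprimep_expl // coprimep_XsubC root_XsubC eq_sym. Qed.

Lemma split_annihilator A :
  exists s : seq K, forall v, pact A (\prod_(z <- s) ('X - z%:P)) v = 0.
Proof.
have [p p0 pA] := annihilator A; have [s e] := closed_field_poly_normal p.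
exists s => v; have := pA v; rewrite e pactZ => /eqP; rewrite scaler_eq0.
by rewrite lead_coef_eq0 (negPf p0) => /eqP.
Qed.

(** The exponent is left existential and v = 0 qualifies for every a. *)
Definition gev A a v := exists n, pact A (('X - a%:P) ^+ n) v = 0.

Lemma gev_eigen A a v : A v = a *: v -> gev A a v.
Proof.
by move=> e; exists 1%N; rewrite expr1 pactD pactN pactC pactX e subrr.
Qed.

(** On the generalized eigenspace for a, A - b is inverted by the polynomial t(A) of a Bezout
    relation r (X - a)^n + t (X - b) = 1; being polynomial in A, it preserves U. *)
Lemma gev_surj A U a b w : (forall u, u \in U -> A u \in U) -> a != b ->
  w \in U -> gev A a w ->
  exists u, [/\ u \in U, gev A a u & A u - b *: u = w].
Proof.
move=> AU ab wU [n wn].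
have [r [t e]] := bezout1 (coprime_XsubC_exp n ab).
exists (pact A t w); split; first exact: pact_stable.
  by exists n; rewrite pactC_comm wn linear0.
rewrite -pactX -(pactC A) -pactN -pactD -pactM mulrC.
have -> : t * ('X - b%:P) = 1 - r * ('X - a%:P) ^+ n by rewrite -e; ring.
by rewrite pactD pactN pactM wn linear0 subr0 -polyC1 pactC scale1r.
Qed.

(** Primary decomposition inside U, by induction on the number of linear factors whose product kills
    v. All factors for one root z are split off at a time: in v = (w p2)(A) v + (u p1)(A) v the
    first part is killed by p1, a power of X - z, and the second by the remaining factors p2. *)
Lemma gev_span A U W : (forall u, u \in U -> A u \in U) ->
  (forall a w, w \in U -> gev A a w -> w \in W) -> (U <= W)%VS.
Proof.
move=> AU gW; apply/subvP => v vU.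
have [s sA] := split_annihilator A; move: {sA}(sA v).
elim: {s}_.+1 {-2}s (ltnSn (size s)) => // n IH [|z s] /= ls in v vU *.
  by rewrite big_nil -polyC1 pactC scale1r => ->; exact: mem0v.
rewrite (bigID (pred1 z)) /= => pv.
set p1 := \prod_(i <- _ | _) _ in pv; set p2 := \prod_(i <- _ | _) _ in pv.
have p1E : p1 = ('X - z%:P) ^+ (count_mem z (z :: s)).
  rewrite /p1 (eq_bigr (fun=> 'X - z%:P)) => [|i /eqP-> //].
  by rewrite big_const_seq iter_mulr_1.
have c12 : coprimep p1 p2.
  rewrite p1E /p2 -big_filter.
  apply: coprimep_prod => y; rewrite mem_filter => /andP[yz _].
  by apply: coprime_XsubC_exp; rewrite eq_sym.
have [u [w e]] := bezout1 c12.
have -> : v = pact A (w * p2) v + pact A (u * p1) v.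
  by rewrite -pactD addrC e -polyC1 pactC scale1r.
apply: memvD.
  apply: (gW z); first exact: pact_stable.
  exists (count_mem z (z :: s)); rewrite -p1E -pactM.
  by rewrite mulrCA pactM pv linear0.
apply: (IH [seq i <- z :: s | i != z]); last 1 first.
- rewrite big_filter -/p2 -pactM.
  by rewrite mulrCA [p2 * _]mulrC pactM pv linear0.
- rewrite /= eqxx /= size_filter.
  exact: leq_ltn_trans (count_size _ _) ls.
- exact: pact_stable.
Qed.

(* The interpolating polynomial comes from the Chinese remainder theorem. *)
Lemma gev_interp A (f : K -> K) :
  exists q, forall a v, gev A a v -> pact A q v = f a *: v.
Proof.
have [s sA] := split_annihilator A; pose n := size s.
have [q qs] : exists q, forall z, z \in s -> ('X - z%:P) ^+ n %| (q - (f z)%:P).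
  elim: {sA}s n => [|z s IH] n; first by exists 0.
  have [q IHq] := IH n.
  have [zs|zs] := boolP (z \in s).
    by exists q => y; rewrite inE => /predU1P[->|]; apply: IHq.
  pose P := \prod_(y <- s) ('X - y%:P) ^+ n.
  have cP : coprimep (('X - z%:P) ^+ n) P.
    apply: coprimep_prod => y ys; rewrite coprimep_expr //; apply: coprime_XsubC_exp.
    by apply: contraNneq zs => ->.
  have [u [w e]] := bezout1 cP.
  (* Since w P is 1 modulo (X - z)^n and 0 modulo the moduli of the other roots, the correction
     changes the residue at z alone. *)
  exists (q + w * P * ((f z)%:P - q)) => y; rewrite inE => /predU1P[->|ys].
    have -> : q + w * P * ((f z)%:P - q) - (f z)%:P
        = (q - (f z)%:P) * (1 - w * P) by ring.
    by rewrite -e addrK mulrA dvdp_mulIr.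
  rewrite addrAC dvdp_add ?IHq // dvdp_mulr // dvdp_mull //.
  by rewrite /P (big_rem y) //= dvdp_mulIl.
exists q => a v [k vk].
pose p1 := ('X - a%:P) ^+ (count_mem a s).
pose p2 := \prod_(z <- s | z != a) ('X - z%:P).
have p1v : pact A p1 v = 0.
  have c12 : coprimep (('X - a%:P) ^+ k) p2.
    rewrite /p2 -big_filter.
    apply: coprimep_prod => y; rewrite mem_filter => /andP[ya _].
    by apply: coprime_XsubC_exp; rewrite eq_sym.
  have [u [w e]] := bezout1 c12.
  have -> : p1 = u * p1 * ('X - a%:P) ^+ k + w * (p1 * p2).
    by rewrite -[LHS]mulr1 -e; ring.
  rewrite pactD pactM vk linear0 add0r pactM.
  have -> : p1 * p2 = \prod_(z <- s) ('X - z%:P).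
    rewrite (bigID (pred1 a)) /=; congr (_ * _).
    rewrite [RHS](eq_bigr (fun=> 'X - a%:P)) => [|i /eqP-> //].
    by rewrite big_const_seq iter_mulr_1.
  by rewrite sA linear0.
(* If a is not among the roots, then [p1] is 1 and v = 0. *)
have [as_|as_] := boolP (a \in s); last first.
  move: p1v; rewrite /p1; move/count_memPn: as_ => ->.
  by rewrite expr0 -polyC1 pactC scale1r => ->; rewrite linear0 scaler0.
apply/eqP; rewrite -subr_eq0 -(pactC A) -pactN -pactD.
have /dvdpP [r ->] : p1 %| (q - (f a)%:P).
  by apply: dvdp_trans (qs a as_); rewrite dvdp_exp2l // count_size.
by rewrite pactM p1v linear0.
Qed.

End GeneralizedEigenvectors.

(** * Lie algebras, traces and the Killing form *)

Section LieBasics.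
Variables (K : fieldType) (g : lieAlgType K).
Implicit Types (x y z : g) (f h : 'End(g)) (U V W : {vspace g}).

Definition lier y x := lie x y.

HB.instance Definition _ y :=
  GRing.isLinear.Build K g g *:%R (lier y) (@lie_linearl K g y).

Lemma lie0l y : lie 0 y = 0. Proof. exact: (linear0 (lier y)). Qed.
Lemma lieDl x z y : lie (x + z) y = lie x y + lie z y.
Proof. exact: (linearD (lier y)). Qed.
Lemma lieBl x z y : lie (x - z) y = lie x y - lie z y.
Proof. exact: (linearB (lier y)). Qed.
Lemma lieNl x y : lie (- x) y = - lie x y.
Proof. exact: (linearN (lier y)). Qed.
Lemma lieZl c x y : lie (c *: x) y = c *: lie x y.
Proof. exact: (linearZ_LR (lier y)). Qed.

Lemma lieC x y : lie x y = - lie y x.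
Proof.
have := liexx (x + y); rewrite lieDl !linearD /= !liexx add0r addr0.
by move/eqP; rewrite addr_eq0 => /eqP.
Qed.

Lemma lie_leibniz x y z : lie x (lie y z) = lie (lie x y) z + lie y (lie x z).
Proof.
have := lie_jacobi x y z; rewrite (lieC z (lie x y)) (lieC z x) linearN /=.
move/eqP; rewrite -addrA addr_eq0 opprD !opprK => /eqP ->.
by rewrite addrC.
Qed.

Lemma lie_vsP U V W :
  (lie_vs U V <= W)%VS <-> {in U & V, forall u v, lie u v \in W}.
Proof.
split=> [/subvP sW u v uU vV|h].
  apply: sW; rewrite (coord_vbasis uU) -/(lier v _) linear_sum.
  apply: memv_suml => i _; rewrite linearZ memvZ //= /lier.
  rewrite (coord_vbasis vV) linear_sum; apply: memv_suml => j _.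
  rewrite linearZ memvZ //=; apply: memv_span.
  by apply: allpairs_f; apply: mem_nth; rewrite size_tuple.
apply/span_subvP => x /allpairsP [[u v] /= [/vbasis_mem uU /vbasis_mem vV ->]].
exact: h.
Qed.

Lemma mem_lie_vs U V x y : x \in U -> y \in V -> lie x y \in lie_vs U V.
Proof. by move=> xU yV; apply: (lie_vsP U V _).1; rewrite ?subvv. Qed.

Lemma ad_lie x y : ad (lie x y) = ((ad x \o ad y) - (ad y \o ad x))%VF.
Proof.
apply/lfunP => z; rewrite add_lfunE opp_lfunE !comp_lfunE !adE.
by rewrite lie_leibniz addrK.
Qed.

Lemma lfun_traceD f h : lfun_trace (f + h) = lfun_trace f + lfun_trace h.
Proof. by rewrite /lfun_trace linearD mxtraceD. Qed.

Lemma lfun_traceZ c f : lfun_trace (c *: f) = c * lfun_trace f.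
Proof. by rewrite /lfun_trace linearZ mxtraceZ. Qed.

Lemma lfun_traceB f h : lfun_trace (f - h) = lfun_trace f - lfun_trace h.
Proof. by rewrite -scaleN1r lfun_traceD lfun_traceZ mulN1r. Qed.

Lemma lfun_traceC f h : lfun_trace (f \o h)%VF = lfun_trace (h \o f)%VF.
Proof. by rewrite /lfun_trace !(mxof_comp _ _ (vbasisP _)) mxtrace_mulC. Qed.

Lemma killingC x y : killing x y = killing y x.
Proof. exact: lfun_traceC. Qed.

Lemma ad_linear : linear (@ad K g).
Proof.
move=> c x y; apply/lfunP => z.
by rewrite add_lfunE scale_lfunE !adE lieDl lieZl.
Qed.

HB.instance Definition _ :=
  GRing.isLinear.Build K g 'End(g) *:%R (@ad K g) ad_linear.

Lemma trace_ad_linear f : scalar (fun x => lfun_trace (f \o ad x)%VF).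
Proof.
move=> c x y; rewrite linearP comp_lfunDr -comp_lfunZr lfun_traceD.
by rewrite lfun_traceZ.
Qed.

Lemma killing_linear x : scalar (killing x).
Proof. exact: trace_ad_linear. Qed.

HB.instance Definition _ x :=
  GRing.isLinear.Build K g K *%R (killing x) (killing_linear x).

Lemma killingZr c x y : killing x (c *: y) = c * killing x y.
Proof. by rewrite linearZ. Qed.

Lemma killing_lie x y z : killing (lie x y) z = killing x (lie y z).
Proof.
rewrite /killing !ad_lie !(comp_lfunDl, comp_lfunDr, comp_lfunNl, comp_lfunNr).
rewrite !lfun_traceB; congr (_ - _); first by rewrite comp_lfunA.
by rewrite -comp_lfunA lfun_traceC -comp_lfunA.
Qed.

Lemma killing_lier x y z : killing x (lie y z) = - killing (lie y x) z.
Proof. by rewrite -killing_lie lieC killingC linearN killingC. Qed.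

Lemma max_subspace (P : {vspace g} -> Prop) : (exists U, P U) ->
  exists2 U, P U & forall V, P V -> (\dim V <= \dim U)%N.
Proof.
case=> U0 PU0; pose Q n := `[< exists2 U : {vspace g}, \dim U = n & P U >].
have exQ : exists n, Q n by exists (\dim U0); apply/asboolP; exists U0.
have bQ n : Q n -> (n <= \dim {:g})%N.
  by move=> /asboolP [U <- _]; apply/dimvS/subvf.
case: (ex_maxnP exQ bQ) => n /asboolP [U dU PU] max_n.
by exists U => // V PV; rewrite dU; apply: max_n; apply/asboolP; exists V.
Qed.

Lemma dim_add_line U x : (\dim (U + <[x]>) <= \dim U)%N -> x \in U.
Proof.
rewrite (geq_leqif (dimv_leqif_sup (addvSl U _))) subv_add => /andP[_].
by rewrite -memvE.
Qed.

(** Lets a property closed under linear combinations be tested on a spanning set. A subspace of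
    largest dimension inside P absorbs every x of P, since adding the line of x stays inside P. *)
Lemma subspace_ex (P : g -> Prop) : P 0 ->
    (forall c x y, P x -> P y -> P (c *: x + y)) ->
  exists U : {vspace g}, forall x, x \in U <-> P x.
Proof.
move=> P0 PD.
have [|U UP maxU] := @max_subspace (fun U => forall x, x \in U -> P x).
  by exists 0%VS => x; rewrite memv0 => /eqP->.
exists U => x; split=> [|Px]; first exact: UP.
apply/dim_add_line/maxU => _ /memv_addP [u uU [_ /vlineP [c ->] ->]].
by rewrite addrC; apply: PD => //; apply: UP.
Qed.

End LieBasics.

(** * Traces and nilpotency through eigenvalues *)

Section Traces.
Variables (K : closedFieldType) (g : lieAlgType K).
Implicit Types (x y z v w : g) (f h A B : 'End(g)) (U V W : {vspace g}).

(** The list s is that of the roots of the characteristic polynomial with multiplicity; minus their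
    sum is its subleading coefficient. *)
Lemma trace_eigen f : exists s : seq K, lfun_trace f = \sum_(a <- s) a /\
  forall a, a \in s <-> exists2 v, v != 0 & f v = a *: v.
Proof.
rewrite /lfun_trace; set e := vbasis _; have eb : basis_of fullv e := vbasisP _.
set M := mxof e e f.
have [s sE] := closed_field_poly_normal (char_poly M).
rewrite (monicP (char_poly_monic M)) scale1r in sE.
exists s; split.
  have sz : size s = \dim {:g}.
    by have := size_char_poly M; rewrite sE size_prod_XsubC => -[].
  (* In dimension zero there is no subleading coefficient. *)
  case: (posnP (\dim {:g})) => d0.
    rewrite d0 in sz; rewrite (size0nil sz) big_nil /mxtrace big_pred0 // => i.
    by have := ltn_ord i; rewrite {2}d0.
  apply: oppr_inj; rewrite -char_poly_trace // sE -sz coefPn_prod_XsubC //.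
  by rewrite sz -lt0n.
move=> a; rewrite -(root_prod_XsubC s) -sE -eigenvalue_root_char.
split=> [/eigenvalueP [v vM v0]|[v v0 fv]].
  exists (vecof e v); first by rewrite vecof_eq0.
  by apply: (can_inj (rVofK eb)); rewrite -mul_mxof vM linearZ /= vecofK.
apply/eigenvalueP; exists (rVof e v); last by rewrite rVof_eq0.
by rewrite mul_mxof rVofK // fv linearZ.
Qed.

Lemma iter_eigen f a v n : f v = a *: v -> iter n f v = a ^+ n *: v.
Proof.
by move=> fv; elim: n => [|n IH]; rewrite ?scale1r //= IH linearZ /= fv scalerA exprSr.
Qed.

Lemma nilpotent_trace f : (forall v, exists n, iter n f v = 0) -> lfun_trace f = 0.
Proof.
move=> nf; have [s [-> sE]] := trace_eigen f.
rewrite big_seq big1 // => a /sE [v v0 /iter_eigen fv]; have [n fn] := nf v.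
move: fn; rewrite fv => /eqP; rewrite scaler_eq0 (negPf v0) orbF expf_eq0.
by case/andP => _ /eqP.
Qed.

Lemma gev_eigenval A a b v : gev A a v -> v != 0 -> A v = b *: v -> b = a.
Proof.
move=> [n vn] v0 e; apply/eqP; rewrite -subr_eq0.
suff pv k : pact A (('X - a%:P) ^+ k) v = (b - a) ^+ k *: v.
  by move: vn => /eqP; rewrite pv scaler_eq0 (negPf v0) orbF expf_eq0 => /andP[].
elim: k => [|k IH]; first by rewrite !expr0 -polyC1 pactC.
rewrite exprS pactM IH pactD pactN pactX pactC linearZ /= e.
by rewrite !scalerA -scalerBl; congr (_ *: _); rewrite exprS; ring.
Qed.

Lemma gev_neq0_eigen A a v : gev A a v -> v != 0 ->
  exists2 w, w != 0 & A w = a *: w.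
Proof.
case=> n; elim: n => [|n IH] in v *.
  by rewrite expr0 -polyC1 pactC scale1r => ->; rewrite eqxx.
rewrite exprSr pactM; set w := pact A _ v => wn v0.
have [w0|] := eqVneq w 0; last exact: IH.
exists v => //; move: w0; rewrite /w pactD pactN pactX pactC.
by move/eqP; rewrite subr_eq0 => /eqP.
Qed.

Lemma nilpotent_subspace f : exists W : {vspace g},
  forall v, v \in W <-> exists n, iter n f v = 0.
Proof.
apply: subspace_ex => [|c x y [m xm] [n yn]]; first by exists 0%N.
exists (m + n)%N; rewrite linearP /= [iter _ f y]iterD yn linear0 addr0.
by rewrite addnC iterD xm linear0 scaler0.
Qed.

Lemma gev_eigen0 A : (forall a v, v != 0 -> A v = a *: v -> a = 0) ->
  forall v, exists n, iter n A v = 0.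
Proof.
move=> A0; have [W WE] := nilpotent_subspace A.
suff /subvP sW : (fullv <= W)%VS by move=> v; apply/WE/sW/memvf.
apply: (@gev_span _ _ A) => [u _|a w _ wa]; first exact: memvf.
have [->|w0] := eqVneq w 0; first exact: mem0v.
have [u u0 ua] := gev_neq0_eigen wa w0.
have a0 := A0 a u u0 ua; rewrite a0 in wa; have [n wn] := wa.
by apply/WE; exists n; rewrite -pactXn -wn subr0.
Qed.

End Traces.

Section NilpotencyCriterion.
Variables (K : numClosedFieldType) (g : lieAlgType K).
Implicit Types (x y z v w : g) (A B : 'End(g)).

(** B is the polynomial in A that interpolates complex conjugation, so it commutes with all that
    commutes with A. *)
Lemma conj_operator A : exists B : 'End(g),
  [/\ forall a v, gev A a v -> B v = a^* *: v &
      forall C : 'End(g), (forall v, C (A v) = A (C v)) ->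
        forall v, C (B v) = B (C v)].
Proof.
have [q qE] := gev_interp A Num.conj; exists (linfun (pact A q)); split.
  by move=> a v av; rewrite lfunE /= (qE a).
by move=> C CA v; rewrite !lfunE /=; apply: pact_comm.
Qed.

(* The trace is the sum of the squared moduli of the eigenvalues of A. *)
Lemma conj_trace_nilpotent A B : (forall v, A (B v) = B (A v)) ->
  (forall a v, gev A a v -> B v = a^* *: v) ->
  lfun_trace (A \o B)%VF = 0 -> forall v, exists n, iter n A v = 0.
Proof.
move=> AB Bconj; have [s [-> sE]] := trace_eigen (A \o B)%VF.
move=> sum0; apply: gev_eigen0 => b w w0 wb.
(* The eigenspace U of A B for a is stable under A, so it contains a generalized eigenvector of A
   for some c, and there a is c times its conjugate. *)
have s_ge0 a : a \in s -> 0 <= a.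
  case/sE => v v0 va; pose U := lker ((A \o B)%VF - a *: \1%VF).
  have UE u : u \in U <-> A (B u) = a *: u.
    rewrite memv_ker add_lfunE opp_lfunE scale_lfunE id_lfunE comp_lfunE subr_eq0.
    by split=> /eqP.
  apply: contrapT => a_neg.
  suff /subvP/(_ v) : (U <= 0)%VS.
    rewrite memv0 (negPf v0) => /implyP; rewrite implybF => /negP [].
    by apply/UE; rewrite -va comp_lfunE.
  apply: (@gev_span _ _ A) => [u /UE uU|c u /UE uU uc].
    by apply/UE; rewrite -AB uU linearZ.
  rewrite memv0; apply: contrapT => /negP u0; apply: a_neg.
  move: uU; rewrite (Bconj _ _ uc) linearZ /=.
  have [->|c0] := eqVneq c 0.
    rewrite conjC0 scale0r => /esym/eqP; rewrite scaler_eq0 (negPf u0) orbF.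
    by move/eqP->.
  move=> e; have Au : A u = (c^*^-1 * a) *: u.
    by rewrite -scalerA -e scalerA mulVf ?conjC_eq0 // scale1r.
  move: (gev_eigenval uc u0 Au) => cE.
  by rewrite -[a](mulVKf (_ : c^* != 0)) ?conjC_eq0 // cE mulrC mul_conjC_ge0.
(* An eigenvalue b of A puts |b|^2 into a vanishing sum of nonnegative terms. *)
have bs : b * b^* \in s.
  apply/sE; exists w => //; rewrite comp_lfunE (Bconj b) ?linearZ /= ?wb ?scalerA.
    by rewrite mulrC.
  exact: gev_eigen.
move: sum0; rewrite big_seq => /eqP; rewrite psumr_eq0; last by move=> a /s_ge0.
move=> /allP/(_ _ bs)/implyP/(_ bs).
by rewrite mul_conjC_eq0 => /eqP.
Qed.

End NilpotencyCriterion.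

(** * Engel's theorem and Cartan's criterion *)

Section Engel.
Variables (K : fieldType) (g : lieAlgType K).
Implicit Types (x y z v w : g) (N U V W : {vspace g}).

Definition lie_stable N U := {in N & U, forall x u, lie x u \in U}.

Lemma lie_stable_addline N U w : lie_stable N U ->
  {in N, forall x, lie x w \in U} -> lie_stable N (U + <[w]>).
Proof.
move=> NU Nw x v xN /memv_addP [u uU [_ /vlineP [c ->] ->]].
rewrite linearD linearZ /=; apply: (subvP (addvSl _ _)).
by apply: memvD; [exact: NU | apply/memvZ/Nw].
Qed.

(* Engel's theorem for the action of N on the quotient W / U. *)
Lemma engel N U W : lie_stable N N ->
    {in N & N, forall x y, exists n, iter n (lie x) y = 0} ->
    lie_stable N U -> lie_stable N W ->
    {in N & W, forall x w, exists n, iter n (lie x) w \in U} ->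
    ~~ (W <= U)%VS ->
  exists w, [/\ w \in W, w \notin U & {in N, forall x, lie x w \in U}].
Proof.
elim: {N}_.+1 {-2}N (ltnSn (\dim N)) U W => // d IH N dN U W NN nilN NU NW nilW WU.
have [N0|N0] := eqVneq N 0%VS.
  have /subvPn [w wW wU] := WU; exists w; split=> // x.
  by rewrite N0 memv0 => /eqP->; rewrite lie0l mem0v.
(* M is a maximal proper subalgebra of N. Induction, applied to M acting on N / M, yields x outside
   M that normalizes M, whence N = M + <x>. *)
pose P M := [/\ (M <= N)%VS, lie_stable M M & ~~ (N <= M)%VS].
have [|M [MN MM NM] maxM] := @max_subspace _ _ P.
  exists 0%VS; split; rewrite ?sub0v ?subv0 //.
  by move=> x y; rewrite !memv0 => /eqP-> _; rewrite lie0l.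
have sMN := subvP MN.
have dM : (\dim M < d)%N.
  rewrite -ltnS (leq_trans _ dN) // !ltnS ltn_neqAle dimvS // andbT.
  by apply: contra NM => /eqP dMN; rewrite -(geq_leqif (dimv_leqif_sup MN)) dMN.
have [x [xN xM Mx]] : exists x, [/\ x \in N, x \notin M & {in M, forall y, lie y x \in M}].
  apply: (IH M dM M N) => //.
  - by move=> y z yM zM; apply: nilN; apply: sMN.
  - by move=> y z yM zN; apply: NN => //; apply: sMN.
  - move=> y z yM zN; have [n yz] := nilN y z (sMN _ yM) zN.
    by exists n; rewrite yz mem0v.
have NE : (N <= M + <[x]>)%VS.
  apply: contraR xM => NMx; apply/dim_add_line/maxM; split=> //.
    by rewrite subv_add MN -memvE.
  move=> _ z /memv_addP [u uM [_ /vlineP [c ->] ->]] zMx.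
  rewrite lieDl memvD ?(lie_stable_addline MM Mx uM zMx) // lieZl memvZ //.
  case/memv_addP: zMx => t tM [_ /vlineP [b ->] ->].
  apply: (subvP (addvSl _ _)).
  by rewrite linearD linearZ /= liexx scaler0 addr0 lieC memvN Mx.
have [w0 [w0W w0U Mw0]] : exists w,
    [/\ w \in W, w \notin U & {in M, forall y, lie y w \in U}].
  apply: (IH M dM U W) => //.
  - by move=> y z yM zM; apply: nilN; apply: sMN.
  - by move=> y z yM; apply: NU; apply: sMN.
  - by move=> y z yM; apply: NW; apply: sMN.
  - by move=> y z yM; apply: nilW; apply: sMN.
have [n xw0] := nilW x w0 xN w0W.
(* As x normalizes M, [lie x] preserves the vectors of W sent into U by M. It is nilpotent modulo U,
   and the last iterate outside U is the wanted vector. *)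
elim: n w0 w0W w0U Mw0 xw0 => [|n IHn] w wW wU Mw xw.
  by rewrite xw in wU.
have [xwU|xwU] := boolP (lie x w \in U).
  exists w; split=> // y /(subvP NE) /memv_addP [u uM [_ /vlineP [c ->] ->]].
  by rewrite lieDl lieZl memvD ?memvZ // Mw.
apply: (IHn (lie x w)); rewrite -?iterSr //; first exact: NW.
move=> y yM; rewrite lie_leibniz memvD ?Mw ?Mx //.
by apply: NU => //; apply: Mw.
Qed.

(** A maximal proper N-stable subspace U of N has codimension one, because Engel's theorem supplies
    w outside U with [N, w] in U. Hence [N, N] lies in U and has smaller dimension. *)
Lemma engel_solvable N : lie_stable N N ->
  {in N & N, forall x y, exists n, iter n (lie x) y = 0} -> lie_solvable N.
Proof.
elim: {N}_.+1 {-2}N (ltnSn (\dim N)) => // d IH N dN NN nilN.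
have [->|N0] := eqVneq N 0%VS; first by exists 0%N.
pose P U := [/\ (U <= N)%VS, lie_stable N U & ~~ (N <= U)%VS].
have [|U [UN NU NnU] maxU] := @max_subspace _ _ P.
  exists 0%VS; split; rewrite ?sub0v ?subv0 //.
  by move=> x y _; rewrite memv0 => /eqP->; rewrite linear0 mem0v.
have [w [wN wU Nw]] : exists w,
    [/\ w \in N, w \notin U & {in N, forall x, lie x w \in U}].
  apply: engel => // x y xN yN; have [n xy] := nilN x y xN yN.
  by exists n; rewrite xy mem0v.
have NE : (N <= U + <[w]>)%VS.
  apply: contraR wU => NUw; apply/dim_add_line/maxU; split=> //.
    by rewrite subv_add UN -memvE.
  exact: lie_stable_addline.
have sU : (lie_vs N N <= U)%VS.
  apply/lie_vsP => x y xN /(subvP NE) /memv_addP [u uU [_ /vlineP [c ->] ->]].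
  by rewrite linearD linearZ /= memvD ?memvZ ?Nw ?NU.
have sN := subvP (subv_trans sU UN).
have [n nN] : lie_solvable (lie_vs N N).
  apply: IH => [|x y xN yN|x y xN yN].
  - rewrite -ltnS (leq_trans _ dN) // !ltnS (leq_ltn_trans (dimvS sU)) //.
    rewrite ltn_neqAle dimvS // andbT.
    by apply: contra NnU => /eqP dUN; rewrite -(geq_leqif (dimv_leqif_sup UN)) dUN.
  - by apply: mem_lie_vs; apply: sN.
  - by apply: nilN; apply: sN.
by exists n.+1; rewrite iterSr.
Qed.

End Engel.

(** * Derivations from generalized eigenspaces; Cartan's criterion *)

Section CartanCriterion.
Variables (K : numClosedFieldType) (g : lieAlgType K).
Implicit Types (x y z v w : g) (A B : 'End(g)) (U W : {vspace g}).

Definition derivation A := forall x y, A (lie x y) = lie (A x) y + lie x (A y).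

(** By the Leibniz rule ad x - (a + b) acts on a bracket as ad x - a on the left factor plus ad x -
    b on the right one; in its (m + n)-th power each term kills one of the factors. *)
Lemma gev_lie x a b y z : gev (ad x) a y -> gev (ad x) b z ->
  gev (ad x) (a + b) (lie y z).
Proof.
have step u w : pact (ad x) ('X - (a + b)%:P) (lie u w)
    = lie (pact (ad x) ('X - a%:P) u) w + lie u (pact (ad x) ('X - b%:P) w).
  rewrite !pactD !pactN !pactX !pactC !adE lie_leibniz lieDl lieNl lieZl.
  rewrite [lie u (_ - _)]linearB /= [lie u (b *: w)]linearZ /= scalerDl opprD !addrA.
  by congr (_ + _); rewrite addrAC.
move=> [m ym] [n zn]; exists (m + n)%N.
have [k kE] : exists k, k = (m + n)%N by exists (m + n)%N.
rewrite -kE; elim: k m n y z ym zn kE => [|k IH] m n y z ym zn mn.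
  move/esym/eqP: mn ym; rewrite addn_eq0 => /andP[/eqP-> _].
  by rewrite !expr0 -polyC1 !pactC !scale1r => ->; rewrite lie0l.
rewrite exprSr pactM step linearD /=.
case: m ym mn => [|m] ym mn.
  by move: ym; rewrite expr0 -polyC1 pactC scale1r => ->; rewrite linear0 !lie0l !linear0 addr0.
case: n zn mn => [|n] zn mn.
  by move: zn; rewrite expr0 -polyC1 pactC scale1r => ->; rewrite linear0 !linear0 addr0.
rewrite (IH m n.+1) ?(IH m.+1 n) ?addr0 //.
- by rewrite -pactM -exprSr.
- by move: mn; rewrite addnS => -[].
- by rewrite -pactM -exprSr.
- by move: mn; rewrite addSn => -[].
Qed.

(** The bracket adds eigenvalues and f is additive, so the Leibniz rule holds on generalized
    eigenvectors, and these span. *)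
Lemma interp_derivation (f : K -> K) x A : {morph f : a b / a + b} ->
  (forall a v, gev (ad x) a v -> A v = f a *: v) -> derivation A.
Proof.
move=> fD AE; pose P y z := A (lie y z) = lie (A y) z + lie y (A z).
have span (Q : g -> Prop) : Q 0 -> (forall c y z, Q y -> Q z -> Q (c *: y + z)) ->
    (forall a v, gev (ad x) a v -> Q v) -> forall v, Q v.
  move=> Q0 QD Qg v; have [W WE] := subspace_ex Q0 QD.
  apply/WE; apply: (subvP _ v (memvf v)).
  apply: (@gev_span _ _ (ad x)) => [u _|a w _ /Qg /WE //]; exact: memvf.
move=> y z; rewrite -/(P y z).
apply: (span (P^~ z)) y => [|c y1 y2|a y ya]; rewrite /P.
- by rewrite !lie0l !linear0 lie0l addr0.
- move=> h1 h2; rewrite lieDl lieZl !linearP /= h1 h2 !lieDl !lieZl.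
  by rewrite scalerDr !addrA; congr (_ + _); rewrite addrAC.
apply: (span (P y)) z => [|c z1 z2|b z zb]; rewrite /P.
- by rewrite !linear0 addr0.
- move=> h1 h2; rewrite !linearP /= h1 h2 scalerDr !addrA.
  by congr (_ + _); rewrite addrAC.
rewrite (AE _ _ (gev_lie ya zb)) (AE _ _ ya) (AE _ _ zb) fD.
by rewrite lieZl linearZ /= scalerDl.
Qed.

Lemma derivation_ad A x : derivation A ->
  ad (A x) = ((A \o ad x) - (ad x \o A))%VF.
Proof.
move=> dA; apply/lfunP => z; rewrite add_lfunE opp_lfunE !comp_lfunE !adE dA.
by rewrite addrK.
Qed.

Lemma conj_derivation x : exists A : 'End(g), [/\ derivation A,
    lfun_trace (ad x \o A)%VF = 0 -> forall v, exists n, iter n (lie x) v = 0 &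
    forall C : 'End(g), (forall v, C (lie x v) = lie x (C v)) ->
      forall v, C (A v) = A (C v)].
Proof.
have [A [AE CA]] := conj_operator (ad x); exists A; split.
- by apply: interp_derivation AE => a b; rewrite rmorphD.
- move=> tr0 v; have [|n xv] := conj_trace_nilpotent _ AE tr0 v; first exact: CA.
  exists n; rewrite -[RHS]xv; apply: eq_iter => u; exact/esym/adE.
- by move=> C Cx v; apply: CA => u; rewrite !adE.
Qed.

(** For u, v in the radical I, the trace of A composed with ad [u, v] is, up to sign, the Killing
    product of u with A v. It vanishes wherever A v lies, because u is in the radical. So ad x is
    nilpotent for x in [I, I], and Engel's theorem makes I solvable. *)
Lemma killing_nondegenerate : semisimple g ->
  forall x, (forall y, killing x y = 0) -> x = 0.
Proof.
move=> ss x0 x0rad.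
have [|c x y xI yI z|I IE] := @subspace_ex _ g (fun x => forall y, killing x y = 0).
- by move=> y; rewrite killingC linear0.
- by rewrite killingC linearP /= killingC xI killingC yI mulr0 addr0.
have II : lie_ideal I.
  apply/lie_vsP => u v _ vI; apply/IE => y.
  by rewrite lieC killingC linearN /= killingC killing_lie (IE _).1 ?oppr0.
suff I0 : I = 0%VS by apply/eqP; rewrite -memv0 -I0; apply/IE.
apply: ss => //.
have sJ : (lie_vs I I <= I)%VS.
  by apply/lie_vsP => u v _ vI; apply: (lie_vsP _ _ _).1 II _ _ (memvf u) vI.
have [n nJ] : lie_solvable (lie_vs I I).
  apply: engel_solvable => [x y /(subvP sJ) xJ /(subvP sJ) yJ|x y xJ _].
    exact: mem_lie_vs.
  have [A [dA nilA _]] := conj_derivation x; apply: nilA.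
  have [|c u v|W WE] := @subspace_ex _ g (fun x => lfun_trace (A \o ad x)%VF = 0).
  - by rewrite linear0 comp_lfun0r -(scale0r 0) lfun_traceZ mul0r.
  - by move=> hu hv; rewrite trace_ad_linear /= hu hv mulr0 addr0.
  rewrite lfun_traceC; apply/WE; apply: subvP xJ; apply/lie_vsP => u v uI vI.
  apply/WE; rewrite lfun_traceC ad_lie comp_lfunDl comp_lfunNl lfun_traceB.
  rewrite -!comp_lfunA [X in _ - X]lfun_traceC -comp_lfunA -lfun_traceB.
  rewrite -comp_lfunNr -comp_lfunDr -opprB -derivation_ad // comp_lfunNr.
  by rewrite -scaleN1r lfun_traceZ -/(killing u (A v)) (IE _).1 ?mulr0.
by exists n.+1; rewrite iterSr.
Qed.

End CartanCriterion.

(** * Duality for a nondegenerate Killing form *)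

Section NondegenerateKilling.
Variables (K : numClosedFieldType) (g : lieAlgType K).
Implicit Types (x y z v w : g) (A B f : 'End(g)) (U W : {vspace g}).

Hypothesis killing_nd : forall x, (forall y, killing x y = 0) -> x = 0.

Lemma killing_inj x y : (forall z, killing z x = killing z y) -> x = y.
Proof.
move=> xy; apply/eqP; rewrite -subr_eq0; apply/eqP/killing_nd => z.
by rewrite killingC linearB /= xy subrr.
Qed.

Let killing_row v := \row_(i < \dim {:g}) killing (vbasis {:g})`_i v.

Let killing_row_linear : linear killing_row.
Proof. by move=> c u v; apply/rowP => i; rewrite !mxE linearP. Qed.

(** The row of Killing products with a basis is an injective map into a space of the same dimension,
    hence onto. *)
Lemma killing_rep (phi : {scalar g}) : exists k, forall x, phi x = killing x k.
Proof.
pose L := GRing.isLinear.Build K g _ *:%R killing_row killing_row_linear.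
pose kr : {linear g -> 'rV[K]_(\dim {:g})} := HB.pack killing_row L.
have spanE (a b : {scalar g}) : (forall i : 'I_(\dim {:g}),
    a (vbasis {:g})`_i = b (vbasis {:g})`_i) -> forall x, a x = b x.
  move=> ab x; rewrite (coord_vbasis (memvf x)) !linear_sum.
  by apply: eq_bigr => i _; rewrite !linearZ /= ab.
have kr0 : lker (linfun kr) == 0%VS.
  rewrite -subv0; apply/subvP => v; rewrite memv_ker lfunE memv0 => /eqP /rowP vE.
  apply/eqP/killing_nd => y; apply: (spanE (killing v) (\0 : {scalar g})) => i /=.
  by rewrite killingC; have := vE i; rewrite !mxE.
have : \row_i phi (vbasis {:g})`_i \in limg (linfun kr).
  suff /eqP-> : limg (linfun kr) == fullv by exact: memvf.
  rewrite eqEdim subvf limg_dim_eq; last by rewrite (eqP kr0) capv0.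
  by rewrite dimvf dim_matrix; exact: (eq_leq (mul1n _)).
case/memv_imgP => k _ /rowP kE; exists k => x.
rewrite killingC; apply: spanE => i; have := kE i; rewrite lfunE !mxE => ->.
by rewrite killingC.
Qed.

(** The default value of [killing_adj] is excluded here: representability and choice give an adjoint
    function, and nondegeneracy makes it linear. *)
Lemma killing_adjP f x y : killing (f x) y = killing x (killing_adj f y).
Proof.
pose ky y := fun x => killing (f x) y.
have ky_scalar y' : scalar (ky y').
  by move=> c u v; rewrite /ky linearP killingC linearP /= !(killingC y').
have rep y' : exists k, forall x, ky y' x = killing x k.
  pose L := GRing.isLinear.Build K g K *%R (ky y') (ky_scalar y').
  exact: (killing_rep (HB.pack (ky y') L)).
have [Q QE] := choice rep.
have Qlin : linear Q.
  move=> c u v; apply: killing_inj => z.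
  by rewrite linearP /= -!QE /ky linearP.
pose L := GRing.isLinear.Build K g g *:%R Q Qlin.
pose Ql : {linear g -> g} := HB.pack Q L.
have := @xgetPex _ (0 : 'End(g)) [set Q : 'End(g) |
    forall x y, killing (f x) y = killing x (Q y)]%classic.
apply; exists (linfun Ql) => u v /=.
by rewrite (lfunE Ql); exact: QE.
Qed.

(** If b were outside U, some coordinate of b minus its projection to U would be nonzero. That
    coordinate, as a functional, vanishes on U, and the vector representing it contradicts the
    hypothesis. *)
Lemma killing_biorth U b :
  (forall k, (forall s, s \in U -> killing k s = 0) -> killing k b = 0) -> b \in U.
Proof.
move=> h; apply/negPn/negP => bU.
pose w := b - projv U b.
have w0 : w != 0.
  by apply: contra bU; rewrite subr_eq0 => /eqP->; exact: memv_proj.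
have [i wi] : exists i, coord (vbasis {:g}) i w != 0.
  apply: contrapT => /forallNP wi; move/negP: w0; apply; apply/eqP.
  rewrite (coord_vbasis (memvf w)) big1 // => i _.
  by have := wi i; move/negP/negPn/eqP => ->; rewrite scale0r.
pose phi x := coord (vbasis {:g}) i (x - projv U x).
have phi_scalar : scalar phi.
  by move=> c u v; rewrite /phi linearP opprD addrACA -scalerBr linearP.
pose L := GRing.isLinear.Build K g K *%R phi phi_scalar.
have [k kE] := killing_rep (HB.pack phi L : {scalar g}).
have phiE x : phi x = killing x k by exact: kE.
move/negP: wi; apply; apply/eqP; rewrite -[LHS]/(phi b) phiE killingC h // => s sU.
by rewrite killingC -phiE /phi projv_id // subrr linear0.
Qed.

Lemma lie_center x : (forall y, lie x y = 0) -> x = 0.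
Proof.
move=> x0; apply: killing_nd => y; rewrite /killing.
have -> : ad x = 0 by apply/lfunP => z; rewrite adE x0 zero_lfunE.
by rewrite comp_lfun0l -(scale0r 0) lfun_traceZ mul0r.
Qed.

(** Take t representing the functional x -> tr (A ad x). The derivation E = A - ad t has tr (E ad u)
    = 0 for all u, and the Killing product of E x with y is tr (E ad [x, y]). *)
Lemma derivation_inner A : derivation A -> exists t, forall x, A x = lie t x.
Proof.
move=> dA.
pose L := GRing.isLinear.Build K g K *%R _ (trace_ad_linear A).
have [t tE] := killing_rep (HB.pack (fun x => lfun_trace (A \o ad x)%VF) L : {scalar g}).
have {tE}tE x : lfun_trace (A \o ad x)%VF = lfun_trace (ad t \o ad x)%VF.
  by rewrite -/(killing t x) killingC -tE.
exists t => x; rewrite -adE; apply/eqP; rewrite -subr_eq0 -opp_lfunE -add_lfunE.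
set E := A - ad t; apply/eqP.
have dE : derivation E.
  move=> u v; rewrite !add_lfunE !opp_lfunE !adE dA lie_leibniz lieDl lieNl.
  by rewrite linearB /= opprD !addrA; congr (_ + _); rewrite addrAC.
have trE u : lfun_trace (E \o ad u)%VF = 0.
  by rewrite comp_lfunDl comp_lfunNl lfun_traceB tE subrr.
apply: killing_nd => y; rewrite /killing derivation_ad // comp_lfunDl comp_lfunNl.
rewrite lfun_traceB -!comp_lfunA [X in _ - X]lfun_traceC -comp_lfunA -lfun_traceB.
by rewrite -comp_lfunNr -comp_lfunDr -ad_lie trE.
Qed.

End NondegenerateKilling.

(** * Cartan subalgebras *)

Section CartanSubalgebra.
Variables (K : numClosedFieldType) (g : lieAlgType K) (H : {vspace g}).
Implicit Types (x y z v w h : g) (A B f : 'End(g)) (U W : {vspace g}).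

Hypothesis killing_nd : forall x, (forall y, killing x y = 0) -> x = 0.
Hypothesis cartanH : cartan_subalgebra H.

Lemma gev0P A v : gev A 0 v <-> exists n, iter n A v = 0.
Proof. by split=> -[n vn]; exists n; move: vn; rewrite subr0 pactXn. Qed.

Lemma iter_ad n x y : iter n (ad x) y = iter n (lie x) y.
Proof. by apply: eq_iter => u; rewrite adE. Qed.

Lemma cartan_stable : lie_stable H H.
Proof. by case: cartanH => HH _ _ x y xH yH; apply: (lie_vsP _ _ _).1 HH _ _ xH yH. Qed.

Lemma cartan_normalizer x : {in H, forall h, lie h x \in H} -> x \in H.
Proof.
by case: cartanH => _ _ sH Hx; apply: sH => h hH; rewrite lieC memvN Hx.
Qed.

Lemma cartan_nilp h x : h \in H -> x \in H -> exists n, iter n (lie h) x = 0.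
Proof.
case: cartanH => _ [n nH] _ hH xH; exists n; apply/eqP; rewrite -memv0 -nH.
by elim: n {nH} => //= n IH; apply: mem_lie_vs.
Qed.

(** This is g = H + [H, g]. If H acts nilpotently on U modulo H, Engel's theorem and
    self-normalization give U inside H. Otherwise some h splits U into a smaller null component,
    handled by induction, and a part on which ad h is onto. *)
Lemma cartan_sum W : (H <= W)%VS -> (forall h x, h \in H -> lie h x \in W) ->
  forall x, x \in W.
Proof.
move=> HW HgW x.
suff sW U : lie_stable H U -> (H <= U)%VS -> (U <= W)%VS.
  by apply: (subvP (sW fullv _ _)); rewrite ?subvf ?memvf // => ? ? _ _; exact: memvf.
elim: {U}_.+1 {-2}U (ltnSn (\dim U)) => // d IH U dU HU sHU.
have [nilU|] := pselect {in H & U, forall h u, exists n, iter n (lie h) u \in H}.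
  have [UH|UH] := boolP (U <= H)%VS; first exact: subv_trans HW.
  have [w [_ wH Hw]] := engel cartan_stable cartan_nilp cartan_stable HU nilU UH.
  by rewrite cartan_normalizer in wH.
move=> nnil; have [h [u [hH uU hu]]] : exists h u,
    [/\ h \in H, u \in U & forall n, iter n (lie h) u \notin H].
  apply: contrapT => nex; apply: nnil => h u hH uU; apply: contrapT => nn.
  apply: nex; exists h, u; split=> // n; apply/negP => hn; apply: nn.
  by exists n.
have [N NE] := nilpotent_subspace (ad h).
(* The null component of ad h is H-stable, since H is nilpotent and so lies in the generalized
   eigenspace of ad h for 0. *)
have U0W : (U :&: N <= W)%VS.
  apply: IH.
  - rewrite -ltnS (leq_trans _ dU) // !ltnS ltn_neqAle dimvS ?capvSl // andbT.
    apply/negP => /eqP dE; have : (U <= U :&: N)%VS.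
      by rewrite -(geq_leqif (dimv_leqif_sup (capvSl U N))) dE.
    rewrite subv_cap => /andP[_ /subvP/(_ u uU)/NE [n un]].
    by have := hu n; rewrite -iter_ad un mem0v.
  - move=> k v kH /memv_capP [vU /NE vN]; apply/memv_capP; split; first exact: HU.
    apply/NE/gev0P; rewrite -(addr0 0); apply: gev_lie; apply/gev0P => //.
    by have [n kn] := cartan_nilp hH kH; exists n; rewrite iter_ad.
  - rewrite subv_cap sHU; apply/subvP => k kH; apply/NE.
    by have [n kn] := cartan_nilp hH kH; exists n; rewrite iter_ad.
have adU v : v \in U -> ad h v \in U by rewrite adE; apply: HU.
apply: (gev_span adU) => a w wU wa.
have [a0|a0] := eqVneq a 0.
  by apply: (subvP U0W); apply/memv_capP; split=> //; apply/NE/gev0P; rewrite -a0.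
have [v [vU _ <-]] := gev_surj adU a0 wU wa.
by rewrite scale0r subr0 adE HgW.
Qed.

Lemma comm_nilpotent_trace A B : (forall v, A (B v) = B (A v)) ->
  (forall v, exists n, iter n A v = 0) -> lfun_trace (A \o B)%VF = 0.
Proof.
move=> AB nA; apply: nilpotent_trace => v; have [n vn] := nA v; exists n.
have -> : iter n (A \o B)%VF v = iter n B (iter n A v).
  elim: {vn}n => //= n ->; rewrite comp_lfunE AB; congr (B _).
  by move: (iter n A v) => w; elim: n => //= n <-; rewrite AB.
by rewrite vn linear0.
Qed.

Lemma killing_subspace z : exists W : {vspace g}, forall y, y \in W <-> killing z y = 0.
Proof.
by apply: subspace_ex => [|c x y zx zy]; rewrite ?linear0 // linearP /= zx zy mulr0 addr0.
Qed.

(** By g = H + [H, g] and invariance: the product of z with [h, x] is minus that of [h, z] = 0 with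
    x. *)
Lemma cartan_orth z : {in H, forall h, killing z h = 0} ->
  {in H, forall h, lie h z = 0} -> z = 0.
Proof.
move=> zH Hz; have [W WE] := killing_subspace z.
apply: killing_nd => y; apply/WE; apply: cartan_sum => [|h x hH].
  by apply/subvP => h hH; apply/WE/zH.
by apply/WE; rewrite killing_lier Hz // killingC linear0 oppr0.
Qed.

Lemma ad_comm x y v : lie x y = 0 -> ad x (ad y v) = ad y (ad x v).
Proof. by move=> xy; rewrite !adE lie_leibniz xy lie0l add0r. Qed.

(** The conjugation operator A of ad z commutes with ad y for y in H, so tr (A ad [x, y]) = 0 and ad
    z is nilpotent. Then ad z ad h is nilpotent too, and z is orthogonal to H. *)
Lemma cartan_central_comm z : z \in lie_vs H H -> {in H, forall h, lie h z = 0} ->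
  z = 0.
Proof.
move=> zHH Hz; apply: cartan_orth => // h hH.
have [A [_ nilA CA]] := conj_derivation z.
apply: comm_nilpotent_trace => v; first by rewrite ad_comm // lieC Hz ?oppr0.
have [|n zn] := nilA _ v; last by exists n; rewrite iter_ad.
have [|c u w|W WE] := @subspace_ex _ g (fun x => lfun_trace (A \o ad x)%VF = 0).
- by rewrite linear0 comp_lfun0r -(scale0r 0) lfun_traceZ mul0r.
- by move=> hu hw; rewrite trace_ad_linear /= hu hw mulr0 addr0.
rewrite lfun_traceC; apply/WE; apply: subvP zHH; apply/lie_vsP => x y _ yH; apply/WE.
have Ay : (A \o ad y = ad y \o A)%VF.
  apply/lfunP => u; rewrite !comp_lfunE CA // => w.
  by rewrite -!(adE z) ad_comm // Hz.
rewrite ad_lie comp_lfunDr comp_lfunNr lfun_traceB comp_lfunA comp_lfunA Ay.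
by rewrite -(comp_lfunA (ad y)) [X in _ - X]lfun_traceC subrr.
Qed.

Lemma cartan_abelian : {in H & H, forall h k, lie h k = 0}.
Proof.
have [_ [n0 nH0] _] := cartanH.
have exn : exists n, iter n (lie_vs H) H == 0%VS by exists n0; apply/eqP.
(* If the lower central series of H had at least two nonzero terms, the last one would lie in [H, H]
   and be central in H. *)
case: (ex_minnP exn) => -[|[|n]] /eqP nH min_n h k hH kH.
- by move: hH; rewrite [H]nH memv0 => /eqP->; rewrite lie0l.
- by apply/eqP; rewrite -memv0 -nH; apply: mem_lie_vs.
have sH m : (iter m (lie_vs H) H <= H)%VS.
  elim: m => [|m IH]; first exact: subvv.
  by apply/lie_vsP => x y xH /(subvP IH) yH; apply: cartan_stable.
suff : iter n.+1 (lie_vs H) H == 0%VS by move/min_n; rewrite ltnn.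
rewrite -subv0; apply/subvP => z zn; rewrite memv0; apply/eqP.
apply: cartan_central_comm => [|x xH].
  apply: subvP zn; apply/lie_vsP => x y xH /(subvP (sH n)) yH; exact: mem_lie_vs.
by apply/eqP; rewrite -memv0 -nH; apply: mem_lie_vs.
Qed.

Lemma cartan_killing_nd h : h \in H -> {in H, forall k, killing h k = 0} -> h = 0.
Proof. by move=> hH hk; apply: cartan_orth => // k kH; apply: cartan_abelian. Qed.

(* The semisimple part of [ad h] is a derivation, hence equal to [ad t] with t
   in H, and h - t is in the radical of the Killing form restricted to H. *)
Lemma cartan_diag h a v : h \in H -> gev (ad h) a v -> lie h v = a *: v.
Proof.
move=> hH va; have [q qE] := gev_interp (ad h) id.
pose s := linfun (pact (ad h) q).
have sE b w : gev (ad h) b w -> s w = b *: w by move=> wb; rewrite lfunE /= (qE b).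
have [t tE] := derivation_inner killing_nd (interp_derivation (f := id) (fun _ _ => erefl) sE).
have sC k w : k \in H -> lie k (s w) = s (lie k w).
  move=> kH; rewrite !lfunE /= -!(adE k) (pact_comm (B := ad k)) // => u.
  by rewrite ad_comm // cartan_abelian.
have tH : t \in H.
  apply: cartan_normalizer => k kH.
  suff -> : lie k t = 0 by exact: mem0v.
  apply: lie_center => // y; have := sC k y kH; rewrite !tE lie_leibniz.
  by move/eqP; rewrite addrC -subr_eq0 addrAC subrr add0r => /eqP.
suff ht : h - t = 0.
  by rewrite -(subrK t h) ht add0r -tE (sE a).
apply: cartan_killing_nd => [|k kH]; first exact: memvB.
apply: comm_nilpotent_trace => w.
  by rewrite ad_comm // cartan_abelian // memvB.
(* On the generalized eigenspace of ad h for b, ad (h - t) is ad h - b. *)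
have [N NE] := nilpotent_subspace (ad (h - t)); apply/NE.
apply: (subvP _ w (memvf w)).
apply: (@gev_span _ _ (ad h)) => [u _|b u _ ub]; first exact: memvf.
have [n un] := ub; apply/NE; exists n; rewrite -un.
elim: n u ub {un} => [|n IH] u ub; first by rewrite expr0 -polyC1 pactC scale1r.
rewrite exprSr pactM iterSr IH.
  by rewrite !pactD !pactN !pactX !pactC adE lieBl -tE (sE b) // adE.
rewrite adE lieBl -tE (sE b) //.
have -> : lie h u - b *: u = pact (ad h) ('X - b%:P) u.
  by rewrite pactD pactN pactX pactC adE.
by case: ub => m um; exists m; rewrite pactC_comm um linear0.
Qed.

(** A plain function of which only the values on H enter stands for a linear form on H; x = 0 has
    every weight. *)
Definition weight (alpha : g -> K) x := {in H, forall h, lie h x = alpha h *: x}.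

(** Simultaneous diagonalization along a list: as H is abelian, an eigenspace of one element is
    stable under the others. *)
Lemma eigen_span (hs : seq g) U W : {subset hs <= H} -> lie_stable H U ->
  (forall x, x \in U -> {in hs, forall h, exists c, lie h x = c *: x} -> x \in W) ->
  (U <= W)%VS.
Proof.
elim: hs U => [|h hs IH] U sH HU UW; first by apply/subvP => x xU; apply: UW.
have hH : h \in H by apply: sH; exact: mem_head.
have adU v : v \in U -> ad h v \in U by rewrite adE; apply: HU.
apply: (gev_span adU) => a w wU /(cartan_diag hH) wa.
pose E := lker (ad h - a *: \1%VF).
have EE x : x \in E <-> lie h x = a *: x.
  rewrite memv_ker add_lfunE opp_lfunE scale_lfunE id_lfunE adE subr_eq0.
  by split=> /eqP.
suff /subvP : (U :&: E <= W)%VS by apply; apply/memv_capP; split=> //; apply/EE.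
apply: IH => [k khs|k x kH /memv_capP [xU /EE xE]|x /memv_capP [xU /EE xE] xhs].
- by apply: sH; rewrite inE khs orbT.
- apply/memv_capP; split; first exact: HU.
  by apply/EE; rewrite -!adE ad_comm ?cartan_abelian // !adE xE linearZ.
apply: UW => // k; rewrite inE => /predU1P [->|]; first by exists a.
exact: xhs.
Qed.

Lemma weight_span U W : lie_stable H U ->
  (forall alpha x, x \in U -> weight alpha x -> x \in W) -> (U <= W)%VS.
Proof.
move=> HU UW; apply: (@eigen_span (vbasis H)) => // [h|x xU xh].
  exact: vbasis_mem.
have [|c h k [a ha] [b kb]|E EE] := @subspace_ex _ g (fun h => exists c, lie h x = c *: x).
- by exists 0; rewrite lie0l scale0r.
- by exists (c * a + b); rewrite lieDl lieZl ha kb scalerA -scalerDl.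
have hex h : exists c, h \in H -> lie h x = c *: x.
  have [hH|hH] := boolP (h \in H); last by exists 0.
  have /EE [c ->] : h \in E; last by exists c.
  apply: subvP hH; rewrite -(span_basis (vbasisP H)); apply/span_subvP => k /xh.
  by move/EE.
have [alpha alphaE] := choice hex.
by apply: (UW alpha) => // h hH; apply: alphaE.
Qed.

Lemma weight_span_full W : (forall alpha x, weight alpha x -> x \in W) ->
  forall x, x \in W.
Proof.
move=> wW x; apply: (subvP _ x (memvf x)).
by apply: weight_span => [? ? _ _|alpha y _]; [exact: memvf | exact: wW].
Qed.

End CartanSubalgebra.

(** * Ladders of eigenvectors and sl2 computations *)

Section Ladders.
Variables (K : numClosedFieldType) (g : lieAlgType K).
Implicit Types (x y z v w h l : g) (b c mu : K).

Lemma eigen_lie h x y b c : lie h x = b *: x -> lie h y = c *: y ->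
  lie h (lie x y) = (b + c) *: lie x y.
Proof. by move=> hx hy; rewrite lie_leibniz hx hy lieZl linearZ /= -scalerDl. Qed.

Lemma eigen_iter_lie h x y b c n : lie h x = b *: x -> lie h y = c *: y ->
  lie h (iter n (lie x) y) = (c + n%:R * b) *: iter n (lie x) y.
Proof.
move=> hx hy; elim: n => [|n IH]; first by rewrite mul0r addr0.
by rewrite /= (eigen_lie hx IH); congr (_ *: _); rewrite -natr1; ring.
Qed.

(** Otherwise the values mu + n b would be infinitely many distinct eigenvalues of ad h. *)
Lemma no_ladder h (w : nat -> g) mu b : b != 0 ->
  (forall n, lie h (w n) = (mu + n%:R * b) *: w n) -> exists n, w n = 0.
Proof.
move=> b0 hw; have [s [_ sE]] := trace_eigen (ad h).
apply: contrapT => /forallNP w0.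
pose t := [seq mu + n%:R * b | n <- iota 0 (size s).+1].
have ut : uniq t.
  rewrite map_inj_uniq ?iota_uniq // => m n /addrI /(mulIf b0) /eqP.
  by rewrite eqr_nat => /eqP.
have : {subset t <= s}.
  move=> _ /mapP [n _ ->]; apply/sE; exists (w n); last by rewrite adE.
  by apply/eqP/w0.
by move/(uniq_leq_size ut); rewrite size_map size_iota ltnn.
Qed.

Lemma iter_lie_vanish h x y b c : b != 0 -> lie h x = b *: x -> lie h y = c *: y ->
  exists n, iter n (lie x) y = 0.
Proof.
by move=> b0 hx hy; apply: (no_ladder b0) => n; apply: eigen_iter_lie hx hy.
Qed.

(** The sl2 formula with e = x, f = y and h = [x, y], not normalized to c = 2, so that the
    degenerate case c = 0 is covered as well. *)
Lemma lie_lowering x y l c mu n :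
  lie (lie x y) y = - c *: y -> lie (lie x y) l = mu *: l -> lie x l = 0 ->
  lie x (iter n.+1 (lie y) l)
    = (n.+1%:R * (mu - n%:R / 2 * c)) *: iter n (lie y) l.
Proof.
move=> hy hl xl; elim: n => [|n IH].
  by rewrite /= lie_leibniz xl linear0 addr0 hl mul0r mul0r subr0 mul1r.
rewrite iterS lie_leibniz IH (eigen_iter_lie _ hy hl) linearZ /= -scalerDl.
by congr (_ *: _); rewrite -[n.+2%:R]natr1 -[n.+1%:R]natr1; field.
Qed.

Lemma lowering_neq0 x y l c mu :
  lie (lie x y) y = - c *: y -> lie (lie x y) l = mu *: l -> lie x l = 0 ->
  (forall n, mu - n%:R / 2 * c != 0) -> l != 0 -> forall n, iter n (lie y) l != 0.
Proof.
move=> hy hl xl coef l0; elim=> // n IH.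
apply: contraNneq IH => n0; have := lie_lowering n hy hl xl.
rewrite n0 linear0 => /esym/eqP; rewrite scaler_eq0 mulf_eq0 pnatr_eq0 /=.
by rewrite (negPf (coef n)).
Qed.

(* Otherwise the vectors ad(y)^n l would all be nonzero, with pairwise distinct
   eigenvalues under ad [x, y]. *)
Lemma sl2_vanish x y l c : c != 0 ->
  lie (lie x y) y = - c *: y -> lie (lie x y) l = - c *: l -> lie x l = 0 -> l = 0.
Proof.
move=> c0 hy hl xl; apply/eqP/negPn/negP => l0.
have [|n nl] := iter_lie_vanish _ hy hl; first by rewrite oppr_eq0.
suff : iter n (lie y) l != 0 by rewrite nl eqxx.
apply: (lowering_neq0 hy hl xl) => // m.
have -> : - c - m%:R / 2 * c = - c * ((m.+2)%:R / 2).
  by rewrite -[m.+2%:R]natr1 -[m.+1%:R]natr1; field.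
by rewrite !mulf_neq0 ?oppr_eq0 ?invr_eq0 ?pnatr_eq0.
Qed.

End Ladders.

Section Weights.
Variables (K : numClosedFieldType) (g : lieAlgType K) (H : {vspace g}).
Implicit Types (x y z v w h l : g) (alpha beta gamma : g -> K).

Hypothesis killing_nd : forall x, (forall y, killing x y = 0) -> x = 0.
Hypothesis cartanH : cartan_subalgebra H.

Local Notation weight := (weight H).

Lemma weight_pair alpha beta x y : weight alpha x -> weight beta y ->
  killing x y != 0 -> {in H, forall h, beta h = - alpha h}.
Proof.
move=> xa yb xy h hH; apply: (mulIf xy); rewrite mulNr.
have := killing_lie x h y; rewrite (lieC x h) xa // yb // -scaleNr.
by rewrite killingC !killingZr killingC mulNr => <-.
Qed.

Lemma cartan_self h : {in H, forall k, lie k h = 0} -> h \in H.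
Proof.
move=> hk; apply: (cartan_normalizer cartanH) => k kH.
by rewrite hk // mem0v.
Qed.

Lemma weight_lie_mem alpha beta x y : weight alpha x -> weight beta y ->
  {in H, forall h, beta h = - alpha h} -> lie x y \in H.
Proof.
move=> xa yb ba; apply: cartan_self => k kH.
by rewrite (eigen_lie (xa _ kH) (yb _ kH)) ba // subrr scale0r.
Qed.

Lemma weight_zero_mem alpha x : weight alpha x -> {in H, forall h, alpha h = 0} ->
  x \in H.
Proof.
by move=> xa a0; apply: cartan_self => k kH; rewrite xa // a0 // scale0r.
Qed.

(* Otherwise h = [x, y] would commute with x and y and act nilpotently. *)
Lemma weight_pair_neq0 alpha beta x y h : weight alpha x -> weight beta y ->
  killing x y != 0 -> {in H, forall h, beta h = - alpha h} ->
  h \in H -> alpha h != 0 -> alpha (lie x y) != 0.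
Proof.
move=> xa yb xy ba hH ah; apply/negP => /eqP a0.
set k := lie x y; have kH : k \in H by apply: weight_lie_mem xa yb ba.
have ky : lie k y = - 0 *: y by rewrite yb // ba // a0.
(* The product of [x, y] with h is alpha(h) times that of x and y, hence nonzero. *)
suff k0 : k = 0.
  have := killing_lie x y h; rewrite -/k k0 killingC linear0 lieC yb // ba //.
  rewrite scaleNr opprK linearZ /= => /esym/eqP.
  by rewrite mulf_eq0 (negPf ah) (negPf xy).
apply: (lie_center killing_nd) => z; rewrite -adE; apply/eqP; rewrite -memv_ker.
apply: (weight_span_full killing_nd cartanH) => gamma w wg.
rewrite memv_ker adE wg // scaler_eq0 -implyNb; apply/implyP => gk.
apply/negPn/negP => w0.
have [n xw] := iter_lie_vanish ah (xa _ hH) (wg _ hH).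
have kx : lie k x = 0 *: x by rewrite xa // a0.
(* Raising by x leaves the eigenvalue under k unchanged, so w may be taken killed by x; the ladder
   downwards by y would then never end. *)
elim: n w gamma wg gk w0 xw => [|n IH] w gamma wg gk w0 xw.
  by move: xw w0 => /= ->; rewrite eqxx.
have [xw0|xw0] := eqVneq (lie x w) 0; last first.
  apply: (IH (lie x w) (fun h => alpha h + gamma h)) => //.
  - by move=> h' h'H; rewrite (eigen_lie (xa _ h'H) (wg _ h'H)).
  - by rewrite a0 add0r.
  - by rewrite -iterSr.
have [|m yw] := iter_lie_vanish _ (yb _ hH) (wg _ hH); first by rewrite ba // oppr_eq0.
suff : iter m (lie y) w != 0 by rewrite yw eqxx.
by apply: (lowering_neq0 ky (wg _ kH)) => // i; rewrite mulr0 subr0.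
Qed.

End Weights.

(** * Averaging operators *)

Section Coefficients.
Variables (K : fieldType) (g : lieAlgType K).
Implicit Types (x y : g) (p q : vpoly nat g).

Lemma vcoef_sum (I : choiceType) (V : lmodType K) (J : Type) (r : seq J) (P : pred J)
    (F : J -> vpoly I V) i :
  vcoef (\sum_(j <- r | P j) F j) i = \sum_(j <- r | P j) vcoef (F j) i.
Proof.
by elim/big_rec2: _ => [|j y q _ <-]; [exact: vcoef0 | exact: vcoefD].
Qed.

Lemma vsupp_sum1 (I : choiceType) (V : lmodType K) (p : vpoly I V) (F : I -> V) m :
  (forall i, i != m -> F i = 0) -> (vcoef p m = 0 -> F m = 0) ->
  \sum_(i <- vsupp p) F i = F m.
Proof.
move=> F0 Fm; have [mp|mp] := boolP (m \in vsupp p).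
  by rewrite (bigD1_seq m) ?fset_uniq //= big1 ?addr0.
rewrite Fm ?vcoef_notin // big_seq big1 // => i ip; apply: F0.
by apply: contraNneq mp => <-.
Qed.

Lemma vsupp_sum_ord (V : lmodType K) (p : vpoly nat V) (F : nat -> V) m :
  (forall i, vcoef p i = 0 -> F i = 0) -> (forall i, (m <= i)%N -> F i = 0) ->
  \sum_(i <- vsupp p) F i = \sum_(i < m) F i.
Proof.
move=> Fp Fm; rewrite -(big_mkord xpredT) /= (bigID (fun i => i < m)%N) /=.
rewrite [X in _ + X]big1 ?addr0 => [|i]; last by rewrite -leqNgt; apply: Fm.
rewrite [RHS](bigID (fun i => i \in vsupp p)) /=.
rewrite [X in _ = _ + X]big1 ?addr0 => [|i /vcoef_notin]; last exact: Fp.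
rewrite -big_filter -[RHS]big_filter; apply: perm_big; apply: uniq_perm.
- by rewrite filter_uniq ?fset_uniq.
- by rewrite filter_uniq ?iota_uniq.
- by move=> i; rewrite !mem_filter mem_index_iota /= andbC.
Qed.

Lemma vcoef_lie_vpolyl p y m : vcoef (lie_vpolyl p y) m = lie (vcoef p m) y.
Proof.
pose F i := vcoef (vmono i (lie (vcoef p i) y)) m.
have FE i : F i = if m == i then lie (vcoef p i) y else 0 by rewrite /F vcoef_mono.
rewrite vcoef_sum (@vsupp_sum1 _ _ p F m) ?FE ?eqxx // => [i im|->].
  by rewrite FE eq_sym (negPf im).
by rewrite lie0l.
Qed.

Lemma vcoef_lie_vpoly p q m k :
  vcoef (lie_vpoly p q) (m, k) = lie (vcoef p m) (vcoef q k).
Proof.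
pose F i j := vcoef (vmono (i, j) (lie (vcoef p i) (vcoef q j))) (m, k).
have FE i j : F i j = if (m == i) && (k == j) then lie (vcoef p i) (vcoef q j) else 0.
  by rewrite /F vcoef_mono xpair_eqE.
have inner i : \sum_(j <- vsupp q) F i j = F i k.
  apply: vsupp_sum1 => [j jk|q0]; rewrite FE.
    by rewrite (eq_sym k) (negPf jk) andbF.
  by rewrite q0 linear0 if_same.
rewrite vcoef_sum (eq_bigr (F^~ k)) => [|i _]; last by rewrite vcoef_sum inner.
rewrite (@vsupp_sum1 _ _ p _ m) ?FE ?eqxx // => [i im|->]; last by rewrite lie0l.
by rewrite FE eq_sym (negPf im).
Qed.

Variable T : {linear g -> vpoly nat g}.

(** This is T_n / n!, for which the averaging identity has integer binomial coefficients. *)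
Definition tau (n : nat) x : g := vcoef (T x) n.

Lemma tau_linear n : linear (tau n).
Proof. by move=> c x y; rewrite /tau linearP vcoefD vcoefZ. Qed.

HB.instance Definition _ n :=
  GRing.isLinear.Build K g g *:%R (tau n) (tau_linear n).

(** In lambda^a (lambda + mu)^n the monomial lambda^m mu^k forces n = k + (m - a); the sum is
    reindexed by i = m - a. *)
Lemma vcoef_T_sum p (m k : nat) : vcoef (T_sum T p) (m, k)
  = \sum_(i < m.+1) tau (k + i) (vcoef p (m - i)%N) *+ 'C(k + i, i).
Proof.
pose G a := if (a <= m)%N then tau (k + (m - a)) (vcoef p a) *+ 'C(k + (m - a), m - a)
            else 0.
rewrite vcoef_sum (eq_bigr G) => [|a _].
  rewrite (@vsupp_sum_ord _ p G m.+1) => [|a a0|a am]; last first.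
  - by rewrite /G leqNgt am.
  - by rewrite /G a0 linear0 mul0rn if_same.
  rewrite (reindex_inj rev_ord_inj); apply: eq_bigr => i _ /=.
  by rewrite subSS /G leq_subr subKn // -ltnS.
pose F n i := vcoef (vmono ((a + i)%N, (n - i)%N) (tau n (vcoef p a) *+ 'C(n, i))) (m, k).
have FE n i : (i < n.+1)%N -> F n i = if (a <= m)%N && (n == k + (m - a))%N && (i == m - a)%N
    then tau n (vcoef p a) *+ 'C(n, i) else 0.
  move=> lin; rewrite /F vcoef_mono xpair_eqE; congr (if _ then _ else _).
  apply/andP/andP => [[/eqP-> /eqP->]|[/andP[am /eqP nE] /eqP iE]].
    by rewrite leq_addr addKn eqxx subnK ?eqxx // -ltnS.
  by rewrite iE nE subnKC // addnK.
have inner n : \sum_(i < n.+1) F n i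
    = if (a <= m)%N && (n == k + (m - a))%N then tau n (vcoef p a) *+ 'C(n, m - a) else 0.
  case: ifPn => [/andP[am /eqP nE]|nn]; last first.
    by apply: big1 => i _; rewrite FE // (negPf nn).
  have mn : (m - a < n.+1)%N by rewrite ltnS nE leq_addl.
  rewrite (bigD1 (Ordinal mn)) //= big1 ?addr0 => [|i]; rewrite FE //.
    by rewrite am nE !eqxx.
  by rewrite -val_eqE /= => /negPf->; rewrite andbF.
rewrite vcoef_sum (eq_bigr (fun n => \sum_(i < n.+1) F n i)) => [|n _]; last first.
  by rewrite vcoef_sum.
rewrite (@vsupp_sum1 _ _ _ _ (k + (m - a))%N) => [|n nE|h].
- by rewrite inner eqxx andbT.
- by rewrite inner (negPf nE) andbF.
- by rewrite inner eqxx andbT /tau h mul0rn if_same.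
Qed.

Lemma averaging_coef x y (m k : nat) : conformal_averaging T ->
  \sum_(i < m.+1) tau (k + i) (lie (tau (m - i) x) y) *+ 'C(k + i, i)
    = lie (tau m x) (tau k y).
Proof.
move=> /(_ x y) avT; rewrite -vcoef_lie_vpoly -avT vcoef_T_sum.
by apply: eq_bigr => i _; rewrite vcoef_lie_vpolyl.
Qed.

(** The degrees of T on a basis bound all degrees; the descending induction starts from this
    bound. *)
Lemma tau_bound : exists N, forall n x, (N <= n)%N -> tau n x = 0.
Proof.
pose e := vbasis {:g}; pose N (i : 'I_(\dim {:g})) := (\max_(n <- vsupp (T e`_i)) n).+1.
exists (\max_i N i) => n x Nn.
rewrite (coord_vbasis (memvf x)) linear_sum big1 // => i _; rewrite linearZ /=.
suff -> : tau n e`_i = 0 by rewrite scaler0.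
apply: vcoef_notin; apply: contraL Nn => ni; rewrite -ltnNge.
apply: leq_trans (leq_bigmax i); rewrite ltnS.
by rewrite (big_rem n) //= leq_maxl.
Qed.

Lemma tau_span : exists S : {vspace g}, forall x,
  x \in S <-> forall W : {vspace g}, (forall n y, tau n y \in W) -> x \in W.
Proof.
apply: subspace_ex => [W _|c x y xS yS W WT]; first exact: mem0v.
by rewrite memvD ?memvZ // (xS, yS).
Qed.

Lemma T_star_span (S : {vspace g}) x : (forall n y, tau n y \in S) ->
  T_star T fullv x -> x \in S.
Proof.
move=> ST [s _ xs]; apply: subvP xs; apply/span_subvP => _ /mapP [c _ ->].
by apply: memv_suml => n _; apply: memvZ; exact: ST.
Qed.

Lemma P_tau u x N : (forall n y, (N <= n)%N -> tau n y = 0) ->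
  P_ T u x = \sum_(n < N) ((u ^+ n.+1)^-1 * n`!%:R) *: tau n x.
Proof.
move=> N0; rewrite P_E.
rewrite (@vsupp_sum_ord _ (T x) (fun n => (u ^+ n.+1)^-1 *: Tn T n x) N).
- by apply: eq_bigr => n _; rewrite lfunE /= /Tn_fun scalerA.
- by move=> n n0; rewrite lfunE /= /Tn_fun n0 !scaler0.
- by move=> n Nn; rewrite lfunE /= /Tn_fun -/(tau n x) N0 // !scaler0.
Qed.

End Coefficients.

(** * Vanishing of the higher coefficients and the Yang-Baxter equation *)

Section Structure.
Variables (K : numClosedFieldType) (g : lieAlgType K) (H S : {vspace g}).
Variable T : {linear g -> vpoly nat g}.
Implicit Types (x y z v w h l a : g) (U W : {vspace g}).

Local Notation weight := (weight H).
Local Notation tau := (tau T).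

Hypothesis killing_nd : forall x, (forall y, killing x y = 0) -> x = 0.
Hypothesis cartanH : cartan_subalgebra H.
Hypothesis avT : conformal_averaging T.
Hypothesis HT : forall h, h \in H -> T_star T fullv h.
Hypothesis mem_S : forall x,
  x \in S <-> forall W : {vspace g}, (forall n y, tau n y \in W) -> x \in W.

Lemma tau_mem n y : tau n y \in S.
Proof. by apply/mem_S => W; apply. Qed.

Lemma cartan_sub_S h : h \in H -> h \in S.
Proof. by move/HT; apply: T_star_span; exact: tau_mem. Qed.

Lemma S_ind (Q : g -> Prop) : Q 0 -> (forall c x y, Q x -> Q y -> Q (c *: x + y)) ->
  (forall n y, Q (tau n y)) -> forall x, x \in S -> Q x.
Proof.
move=> Q0 QD QT x /mem_S xS; have [W WE] := subspace_ex Q0 QD.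
by apply/WE/xS => n y; apply/WE.
Qed.

Lemma S_lie : lie_stable S S.
Proof.
move=> x y xS yS; move: x xS.
apply: S_ind => [|c x x' xy x'y|m x]; first by rewrite lie0l mem0v.
  by rewrite lieDl lieZl memvD ?memvZ.
move: y yS; apply: S_ind => [|c y y' xy xy'|k y]; first by rewrite linear0 mem0v.
  by rewrite linearP memvD ?memvZ.
rewrite -averaging_coef //; apply: memv_suml => i _.
by rewrite -scaler_nat memvZ // tau_mem.
Qed.

Lemma cartan_stable_S : lie_stable H S.
Proof. by move=> h x /cartan_sub_S; exact: S_lie. Qed.

Lemma weight_cases alpha x : weight alpha x ->
  x \in H \/ exists2 h, h \in H & alpha h != 0.
Proof.
move=> xa; have [a0|/existsNP [h]] := pselect (forall h, h \in H -> alpha h = 0).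
  by left; apply: (weight_zero_mem cartanH xa).
by move/not_implyP => [hH /eqP ah]; right; exists h.
Qed.

Definition annihilates m := forall a y, a \in S ->
  tau m (lie a y) = 0 /\ lie a (tau m y) = 0.

(** For a = tau_n x, take the averaging identity in degree n of lambda and m of mu: the terms with i
    > 0 contain tau_(m+i) [S, g] = 0. *)
Lemma tau_comm m : (forall k, (m < k)%N -> annihilates k) ->
  forall a y, a \in S -> tau m (lie a y) = lie a (tau m y).
Proof.
move=> ann a y aS; move: a aS.
apply: S_ind => [|c a b ha hb|n x]; first by rewrite !lie0l linear0.
  by rewrite !lieDl !lieZl linearP /= ha hb.
rewrite -averaging_coef // big_ord_recl /= addn0 subn0 bin0 mulr1n big1 ?addr0 //.
move=> i _; rewrite (ann _ _ _ _ _).1 ?mul0rn ?tau_mem //.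
by rewrite /bump leq0n addnS ltnS leq_addr.
Qed.

(** The averaging identity in degree m + 2 of lambda and m of mu: the right side and the term i = 0
    vanish with tau_(m+2) x, the terms i > 1 by [ann], and the term i = 1 carries the nonzero factor
    m + 1. *)
Lemma tau_sq_step m x y : (forall k, (m.+1 < k)%N -> annihilates k) ->
  tau m.+2 x = 0 -> tau m.+1 (lie (tau m.+1 x) y) = 0.
Proof.
move=> ann x0; have := averaging_coef x y m.+2 m avT.
rewrite x0 lie0l big_ord_recl big_ord_recl /= subn0 x0 lie0l linear0 mul0rn add0r.
rewrite big1 ?addr0 => [|i _]; last first.
  by rewrite (ann _ _ _ _ _).1 ?mul0rn ?tau_mem // !addnS !ltnS leq_addr.
rewrite addn1 subn1 /= bin1 => /eqP.
by rewrite -scaler_nat scaler_eq0 pnatr_eq0 => /eqP.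
Qed.

Lemma weight_tau m alpha x :
  (forall a y, a \in S -> tau m (lie a y) = lie a (tau m y)) ->
  weight alpha x -> weight alpha (tau m x).
Proof. by move=> Sm xa h hH; rewrite -Sm ?cartan_sub_S // xa // linearZ. Qed.

Lemma killing_neq0 x : x != 0 ->
  exists beta y, weight beta y /\ killing x y != 0.
Proof.
move=> x0; apply: contrapT => nex; move/eqP: x0; apply; apply: killing_nd => y.
have [W WE] := killing_subspace x; apply/WE.
apply: (weight_span_full killing_nd cartanH) => beta z zb; apply/WE.
by apply: contrapT => /eqP xz; apply: nex; exists beta, z.
Qed.

(* tau m^* applied to a vector of weight opposite to that of a = tau m x
   yields a vector commuting with a, against sl2 theory. *)
Lemma tau_weight_eq0 m alpha x h : (forall k, (m.+1 < k)%N -> annihilates k) ->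
  weight alpha x -> h \in H -> alpha h != 0 -> tau m.+1 x = 0.
Proof.
move=> ann xa hH ah; have comm := tau_comm ann.
(* A vector of nonzero weight is a multiple of [h, x], which lies in [S, g]. *)
have x2 : tau m.+2 x = 0.
  apply: (scalerI ah); rewrite scaler0 -linearZ /= -xa //.
  by rewrite (ann _ _ _ _ _).1 ?cartan_sub_S.
have sq y := tau_sq_step y ann x2.
apply/eqP/negPn/negP => a0; set a := tau _ x in a0 sq.
have aa : weight alpha a by apply: weight_tau.
have [beta [y [yb ay]]] := killing_neq0 a0.
have ba := weight_pair aa yb ay.
pose l := killing_adj (linfun (tau m.+1)) y.
have lE z : killing z l = killing (tau m.+1 z) y by rewrite -killing_adjP // lfunE.
suff l0 : l = 0 by move: ay; rewrite -lE l0 linear0 eqxx.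
have kH := weight_lie_mem cartanH aa yb ba.
apply: (@sl2_vanish _ _ a y l (alpha (lie a y))).
- exact: (weight_pair_neq0 killing_nd cartanH aa yb ay ba hH ah).
- by rewrite yb // ba.
- apply: (killing_inj killing_nd) => z; rewrite linearZ /= !lE -killing_lie lE.
  rewrite lieC linearN /= comm ?cartan_sub_S // -lieC killing_lie yb // linearZ /=.
  by rewrite ba.
(* The product of z with [a, l] is that of tau_(m+1) [z, a] with y, which is zero by [sq]. *)
- apply: (killing_inj killing_nd) => z; rewrite linear0 -killing_lie lE lieC.
  by rewrite linearN /= sq oppr0 killingC linear0.
Qed.

(** On weight vectors tau_(m+1) [h, z] = 0 for h in H, so H commutes with the image of tau_(m+1).
    For s in S with [h, s] = alpha(h) s and alpha(h) nonzero, the Leibniz rule reduces alpha(h)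
    [s, tau_(m+1) y] to [h, tau_(m+1) [s, y]] = 0. *)
Lemma annihilates_step m : (forall k, (m.+1 < k)%N -> annihilates k) ->
  annihilates m.+1.
Proof.
move=> ann a y aS; have comm := tau_comm ann.
suff ay : lie a (tau m.+1 y) = 0 by rewrite comm.
have tauH h z : h \in H -> lie h (tau m.+1 z) = 0.
  move=> hH; rewrite -comm ?cartan_sub_S //.
  have [|c u v hu hv|W WE] := @subspace_ex _ g (fun z => tau m.+1 (lie h z) = 0).
  - by rewrite !linear0.
  - by rewrite !linearP /= hu hv scaler0 addr0.
  apply/WE; apply: (weight_span_full killing_nd cartanH) => alpha x xa; apply/WE.
  rewrite xa //; have [->|ah] := eqVneq (alpha h) 0; first by rewrite scale0r linear0.
  by rewrite linearZ /= (tau_weight_eq0 ann xa hH ah) scaler0.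
have [|c u v hu hv|W WE] := @subspace_ex _ g (fun a => lie a (tau m.+1 y) = 0).
- by rewrite lie0l.
- by rewrite lieDl lieZl hu hv scaler0 addr0.
apply/WE; apply: subvP aS.
apply: (weight_span killing_nd cartanH cartan_stable_S) => alpha s sS sa.
apply/WE; have [/tauH //|[h hH ah]] := weight_cases sa.
apply: (scalerI ah); rewrite scaler0 -lieZl -sa //.
have := lie_leibniz h s (tau m.+1 y); rewrite (tauH h) // linear0 addr0 => <-.
by rewrite -comm // (tauH h).
Qed.

Lemma annihilates_pos m : annihilates m.+1.
Proof.
have [N N0] := tau_bound T.
(* Here d measures how far the index may lie below the degree bound N. *)
suff ann d : forall k, (N < k + d)%N -> annihilates k.+1.
  by apply: (ann N.+1); rewrite addnS ltnS leq_addl.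
elim: d => [|d IH] k Nk.
  have Nk1 : (N <= k.+1)%N by rewrite addn0 in Nk; apply/leqW/ltnW.
  by move=> a y _; rewrite !N0 // linear0.
apply: annihilates_step => -[|j] // kj; apply: IH.
by apply: leq_trans Nk _; rewrite addnS -addSn leq_add2r.
Qed.

Lemma tau0_comm a y : a \in S -> tau 0 (lie a y) = lie a (tau 0 y).
Proof. by apply: tau_comm => -[|k] // _; apply: annihilates_pos. Qed.

(* For a weight vector k orthogonal to S with a = tau 0 k <> 0, the coroot
   h = [a, y] is orthogonal to S, although it belongs to S. *)
Lemma tau_orth_eq0 n k : {in S, forall s, killing k s = 0} -> tau n k = 0.
Proof.
have [|c u v hu hv s sS|Sp SpE] := @subspace_ex _ g (fun k => {in S, forall s, killing k s = 0}).
- by move=> s _; rewrite killingC linear0.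
- by rewrite killingC linearP /= !(killingC s) hu // hv // mulr0 addr0.
have SSp : lie_stable S Sp.
  move=> a z aS /SpE zS; apply/SpE => s sS.
  by rewrite lieC killingC linearN /= killingC killing_lie zS ?oppr0 // S_lie.
have HSp : {in H, forall h, h \in Sp -> h = 0}.
  move=> h hH /SpE hS; apply: (cartan_killing_nd killing_nd cartanH hH) => h' h'H.
  by rewrite hS // cartan_sub_S.
move=> /SpE kSp; apply/eqP; rewrite -(lfunE (tau n)) -memv_ker.
apply: subvP kSp; have HSp' : lie_stable H Sp.
  by move=> h z hH; apply: SSp; apply: cartan_sub_S.
apply: (weight_span killing_nd cartanH HSp') => alpha {}k kSp ka.
rewrite memv_ker lfunE /=.
have [kH|[h hH ah]] := weight_cases ka; first by rewrite (HSp k) // linear0.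
case: n => [|n]; last first.
  apply/eqP/(scalerI ah); rewrite scaler0 -linearZ /= -ka //.
  by rewrite (annihilates_pos _ _ _).1 ?cartan_sub_S.
apply/negPn/negP => a0; set a := tau 0 k in a0.
have comm := tau0_comm; have aS : a \in S by exact: tau_mem.
have aa : weight alpha a by apply: weight_tau => // *; apply: comm.
have [beta [y [yb ay]]] := killing_neq0 a0.
have ba := weight_pair aa yb ay.
set c := lie a y; have cH : c \in H := weight_lie_mem cartanH aa yb ba.
have c0 : alpha c != 0 by exact: (weight_pair_neq0 killing_nd cartanH aa yb ay ba hH ah).
(* [a, tau_0 y] = - tau_0 [tau_0 y, k], and [tau_0 y, k] has weight zero and is orthogonal to S,
   hence is 0; sl2 theory then applies to tau_0 y. *)
have ty0 : tau 0 y = 0.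
  have tyb : weight beta (tau 0 y) by apply: weight_tau => // *; apply: comm.
  apply: (@sl2_vanish _ _ a y _ (alpha c)) => //; rewrite -/c.
  - by rewrite yb // ba.
  - by rewrite tyb // ba.
  have tykH : lie (tau 0 y) k \in H.
    by apply: (weight_lie_mem cartanH tyb ka) => h' h'H; rewrite ba // opprK.
  rewrite lieC -comm ?tau_mem // (HSp _ tykH) ?linear0 ?oppr0 //.
  by apply: SSp => //; apply: tau_mem.
have tc0 : tau 0 c = 0 by rewrite comm // ty0 linear0.
have ta0 : tau 0 a = 0.
  apply: (scalerI c0); rewrite scaler0 -linearZ /= -aa //.
  by rewrite lieC linearN /= comm // tc0 linear0 oppr0.
have cc : killing c c != 0.
  rewrite killing_lie lieC yb // ba // scaleNr opprK linearZ /=.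
  by rewrite mulf_neq0.
move/negP: cc; apply; apply/eqP.
(* Tested on tau_m w for weight vectors w. A nonzero weight is orthogonal to H; for w in H the
   product is that of [tau_m w, a] with y, which vanishes by tau_0 a = 0 if m = 0 and by
   annihilation otherwise. *)
suff Sc : forall s, s \in S -> killing s c = 0 by apply/Sc/cartan_sub_S.
apply: S_ind => [|e u v hu hv|m x]; first by rewrite killingC linear0.
  by rewrite killingC linearP /= !(killingC c) hu hv mulr0 addr0.
have [|e u v hu hv|W WE] := @subspace_ex _ g (fun x => killing (tau m x) c = 0).
- by rewrite linear0 killingC linear0.
- by rewrite linearP killingC linearP /= !(killingC c) hu hv mulr0 addr0.
apply/WE; apply: (weight_span_full killing_nd cartanH) => gamma w wg; apply/WE.
have [wH|[h' h'H gh']] := weight_cases wg; last first.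
  have tmw : weight gamma (tau m w).
    apply: weight_tau => // b z bS; case: (m) => [|m']; first exact: comm.
    by have [-> ->] := @annihilates_pos m' b z bS.
  apply: (mulfI gh'); rewrite mulr0; have := killing_lie (tau m w) h' c.
  rewrite (cartan_abelian killing_nd cartanH h'H cH) linear0 lieC tmw //.
  by rewrite killingC linearN /= linearZ /= killingC => /eqP; rewrite oppr_eq0 => /eqP.
rewrite -killing_lie lieC; case: m {W WE} => [|m].
  rewrite -comm // lieC linearN /= opprK aa // linearZ /= ta0 scaler0.
  by rewrite killingC linear0.
by rewrite (annihilates_pos _ _ _).2 // oppr0 killingC linear0.
Qed.

Lemma killing_adj_mem (f : 'End(g)) y :
  (forall k, {in S, forall s, killing k s = 0} -> f k = 0) ->
  killing_adj f y \in S.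
Proof.
move=> f0; apply: (killing_biorth killing_nd) => k kS.
by rewrite -killing_adjP // f0 // killingC linear0.
Qed.

(** Q gathers the poles of order at least two: tau_(n+1) comes with u^-(n+2) and with (n+1)!, the
    ratio of T_(n+1) to tau_(n+1). *)
Lemma P_split u : exists Q : 'End(g),
  [/\ forall x, P_ T u x = u^-1 *: tau 0 x + Q x,
      {in S, forall a y, Q (lie a y) = 0},
      {in S, forall a y, lie a (Q y) = 0} &
      forall k, {in S, forall s, killing k s = 0} -> Q k = 0].
Proof.
have [N N0] := tau_bound T.
pose q : 'End(g) := \sum_(n < N) ((u ^+ n.+2)^-1 * n.+1`!%:R) *: linfun (tau n.+1).
have qE x : q x = \sum_(n < N) ((u ^+ n.+2)^-1 * n.+1`!%:R) *: tau n.+1 x.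
  by rewrite sum_lfunE; apply: eq_bigr => n _; rewrite scale_lfunE lfunE.
exists q; split=> [x|a aS y|a aS y|k kS].
- rewrite (@P_tau _ _ T u x N.+1) => [|n y Nn]; last exact/N0/ltnW.
  by rewrite big_ord_recl qE expr1 mulr1; congr (_ + _); apply: eq_bigr.
- by rewrite qE big1 // => n _; rewrite (annihilates_pos _ _ aS).1 scaler0.
- rewrite qE linear_sum big1 // => n _.
  by rewrite linearZ /= (annihilates_pos _ _ aS).2 scaler0.
- by rewrite qE big1 // => n _; rewrite tau_orth_eq0 // scaler0.
Qed.

Lemma P_lie u a y : a \in S -> P_ T u (lie a y) = u^-1 *: lie a (tau 0 y).
Proof.
by move=> aS; have [Q [-> -> // _ _]] := P_split u; rewrite addr0 tau0_comm.
Qed.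

Lemma lie_P u a y : a \in S -> lie a (P_ T u y) = u^-1 *: lie a (tau 0 y).
Proof.
move=> aS; have [Q [-> _ Qa _]] := P_split u.
by rewrite linearD linearZ /= Qa // addr0.
Qed.

Lemma P_mem u x : P_ T u x \in S.
Proof.
rewrite P_E; apply: memv_suml => n _; rewrite memvZ // lfunE /=.
by rewrite /Tn_fun memvZ // tau_mem.
Qed.

Lemma adj_P_mem u y : killing_adj (P_ T u) y \in S.
Proof.
apply: killing_adj_mem => k kS; have [Q [-> _ _ Qk]] := P_split u.
by rewrite Qk // tau_orth_eq0 // scaler0 addr0.
Qed.

(** Paired with z, the bracket tau_0 [P_u^* y, x] becomes the product of y with P_u [x, tau_0^* z].
    As tau_0^* z is in S, P_u acts there as u^-1 tau_0, and moving tau_0^* back gives the right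
    side. *)
Lemma tau0_adj_P u x y :
  lie (killing_adj (P_ T u) y) (tau 0 x) = - u^-1 *: lie (tau 0 x) (tau 0 y).
Proof.
rewrite -tau0_comm ?adj_P_mem //; apply: (killing_inj killing_nd) => z.
rewrite ![killing z _]killingC; pose zt := killing_adj (linfun (tau 0)) z.
have zE w : killing (tau 0 w) z = killing w zt by rewrite -killing_adjP // lfunE.
have ztS : zt \in S.
  by apply: killing_adj_mem => k kS; rewrite lfunE /= tau_orth_eq0.
rewrite zE killing_lie killingC -killing_adjP // lieC linearN /= P_lie //.
rewrite -scaleNr killingC linearZ /= killingC killing_lie killingC -zE.
by rewrite tau0_comm ?tau_mem // [in RHS]killingC linearZ /= killingC.
Qed.

Lemma averaging_yang_baxter x y (u v : K) : u != 0 -> v != 0 -> u + v != 0 ->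
  P_ T (u + v) (lie x (killing_adj (P_ T u) y))
  - P_ T v (lie (P_ T u x) y) + lie (P_ T (u + v) x) (P_ T v y) = 0.
Proof.
move=> u0 v0 uv0; rewrite (lieC x) linearN /=.
rewrite [P_ T (u + v) (lie (killing_adj _ _) _)]P_lie ?adj_P_mem // tau0_adj_P.
have lP (w : K) : lie (P_ T w x) (tau 0 y) = w^-1 *: lie (tau 0 x) (tau 0 y).
  by rewrite lieC lie_P ?tau_mem // -scalerN -lieC.
rewrite P_lie ?P_mem // lie_P ?P_mem // !lP -!scaleNr !scalerA -!scalerDl.
rewrite -[RHS](scale0r (lie (tau 0 x) (tau 0 y))); congr (_ *: _).
by field; rewrite u0 v0 uv0.
Qed.

End Structure.

(** * Meromorphy *)

Section LaurentTail.
Variable K : numFieldType.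
Local Open Scope classical_set_scope.

Lemma derivable_bigsum (V W : normedModType K) n (h : 'I_n -> V -> W) x v :
  (forall i, derivable (h i) x v) -> derivable (fun z => \sum_(i < n) h i z) x v.
Proof.
move=> /derivable_sum; suff -> : (fun z => \sum_(i < n) h i z) = \sum_(i < n) h i by [].
by apply/funext => z; rewrite fct_sumE.
Qed.

Lemma derivable_pow n (x : K^o) : derivable (fun z : K^o => z ^+ n : K^o) x 1.
Proof.
rewrite -(exprfctE (@id K^o) n).
by apply: (@derivableX K K^o (@id K^o) n x 1); exact: derivable_id.
Qed.

Lemma derivable_poly_sum n (e : nat -> nat) (d : nat -> K) (x : K^o) :
  derivable (fun z : K^o => \sum_(i < n) z ^+ e i * d i : K^o) x 1.
Proof.
apply: derivable_bigsum => i.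
apply: (@derivableM K K^o (fun z : K^o => z ^+ e i) (cst (d i)) x 1).
  exact: derivable_pow.
exact: derivable_cst.
Qed.

Lemma derivable_Laurent_sum n (d : nat -> K) (x : K^o) : x != 0 ->
  derivable (fun z : K^o => \sum_(i < n) (z ^+ i.+1)^-1 * d i : K^o) x 1.
Proof.
move=> x0; apply: derivable_bigsum => i.
apply: (@derivableM K K^o (fun z : K^o => (z ^+ i.+1)^-1) (cst (d i)) x 1).
  apply: (@derivableV K K^o (fun z : K^o => z ^+ i.+1) x 1).
    by rewrite expf_neq0.
  exact: derivable_pow.
exact: derivable_cst.
Qed.

Lemma near_neq0 (c : K^o) : c != 0 -> \forall z \near c, z != 0 :> K^o.
Proof. exact: (@cvgr_neq0 K K^o K^o (nbhs c) _ id c (@cvg_id _ _)). Qed.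

Lemma Laurent_pole n (d : nat -> K) (z : K) : z != 0 ->
  z ^+ n * (\sum_(i < n) (z ^+ i.+1)^-1 * d i) = \sum_(i < n) z ^+ (n - i.+1)%N * d i.
Proof.
move=> z0; rewrite mulr_sumr; apply: eq_bigr => i _.
by rewrite mulrA; congr (_ * _); rewrite [in RHS]exprB ?unitfE.
Qed.

End LaurentTail.

Local Open Scope classical_set_scope.
(** By the degree bound N each scalar function is a polynomial in 1/z without constant term, with a
    pole of order at most N at 0. *)
Lemma P_meromorphic (R : realType) (g : lieAlgType R[i])
    (T : {linear g -> vpoly nat g}) : op_meromorphic (P_ T).
Proof.
move=> phi a; have [N N0] := tau_bound T.
pose d n : R[i] := n`!%:R * phi (tau T n a).
have phiE : (fun z => phi (P_ T z a)) = (fun z => \sum_(n < N) (z ^+ n.+1)^-1 * d n).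
  apply/funext => z; rewrite (P_tau _ _ N0) linear_sum; apply: eq_bigr => n _.
  by rewrite linearZ /d mulrA.
rewrite phiE; split=> [c c0|].
  near=> z; apply: derivable_Laurent_sum; near: z; exact: near_neq0.
exists N, (fun z => \sum_(n < N) z ^+ (N - n.+1)%N * d n).
  near=> z; exact: (@derivable_poly_sum R[i] N (fun n => (N - n.+1)%N) d z).
near=> z; rewrite subr0 Laurent_pole //; near: z; exact: nbhs_dnbhs_neq.
Unshelve. all: by end_near. Qed.
Local Close Scope classical_set_scope.

Theorem corollary3 (R : realType) (g : lieAlgType R[i])
    (T : {linear g -> vpoly nat g}) :
  semisimple g -> conformal_averaging T -> homogeneous T ->
  op_meromorphic (P_ T) /\
  forall (x y : g) (u v : R[i]), u != 0 -> v != 0 -> u + v != 0 ->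
    P_ T (u + v) (lie x (killing_adj (P_ T u) y))
    - P_ T v (lie (P_ T u x) y)
    + lie (P_ T (u + v) x) (P_ T v y) = 0.
Proof.
move=> ss avT [H cartanH HT]; split; first exact: P_meromorphic.
move=> x y u v u0 v0 uv0; have [S mem_S] := tau_span T.
exact: (averaging_yang_baxter (killing_nondegenerate ss) cartanH avT HT mem_S).
Qed.
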